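(* Let $\Omega\subset\mathbb{H}^2$ (curvature $-1$) be an unbounded open connected domain with $C^2$ boundary on which there is $u\in C^2(\overline\Omega)$ with $\Delta u+f(u)=0$ in $\Omega$, $u>0$ in $\Omega$, $u=0$ and $\langle\nabla u,\vec v\rangle=\alpha$ on $\partial\Omega$, where $\alpha\neq0$ is a constant and $f:(0,+\infty)\to\mathbb{R}$ is Lipschitz with $f(t)\geq\lambda t$ for all $t>0$ for some constant $\lambda>\frac14$. Let $R_{\lambda,2}$ be the radius of a geodesic ball in $\mathbb{H}^2$ whose first Dirichlet eigenvalue of the Laplacian is $\lambda$, let $v$ be the positive first Dirichlet eigenfunction on a geodesic ball $B(p,R_{\lambda,2})$ normalized so that $\langle\nabla v,\vec v\rangle=\alpha$ on $\partial B(p,R_{\lambda,2})$, and set $h_0=\max v=v(p)$. Then every connected component $\Omega'$ of $\{x\in\Omega:u(x)>h_0\}$ has diameter smaller than $2R_{\lambda,2}$.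
   Context: $\alpha$ is a non-positive constant (here nonzero), and $\vec v$ denotes the outward unit normal of the relevant boundary. *)

(* Defs.v *)
(* Model of H^2: upper half-plane
   {(x,y) : y > 0} with metric (dx^2+dy^2)/y^2 (curvature -1). *)
From HB Require Import structures.
From mathcomp Require Import all_boot all_order all_algebra.
From mathcomp Require Import all_classical all_reals all_analysis.
Set Implicit Arguments. Unset Strict Implicit. Unset Printing Implicit Defensive.
Import Order.TTheory GRing.Theory Num.Theory.
Import numFieldNormedType.Exports.
Local Open Scope classical_set_scope.
Local Open Scope ring_scope.

Definition H2 (R : realType) : set (R * R) := [set z | 0 < z.2].

Definition pdx (R : realType) (u : R * R -> R) : R * R -> R :=
  fun z => derive u z (1, 0).
Definition pdy (R : realType) (u : R * R -> R) : R * R -> R :=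
  fun z => derive u z (0, 1).

Definition hlap (R : realType) (u : R * R -> R) : R * R -> R :=
  fun z => z.2 ^+ 2 * (pdx (pdx u) z + pdy (pdy u) z).

Definition acoshR (R : realType) (t : R) : R := ln (t + Num.sqrt (t ^+ 2 - 1)).
Definition hdist (R : realType) (z w : R * R) : R :=
  acoshR (1 + ((z.1 - w.1) ^+ 2 + (z.2 - w.2) ^+ 2) / (2 * z.2 * w.2)).

Definition hball (R : realType) (p : R * R) (r : R) : set (R * R) :=
  [set z | @H2 R z /\ hdist p z < r].

Definition C1_on (R : realType) (A : set (R * R)) (u : R * R -> R) : Prop :=
  forall z, A z ->
    [/\ differentiable u z, {for z, continuous (pdx u)} &
        {for z, continuous (pdy u)}].

Definition C2_on (R : realType) (A : set (R * R)) (u : R * R -> R) : Prop :=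
  forall z, A z ->
    differentiable u z /\ differentiable (pdx u) z /\ differentiable (pdy u) z /\
    {for z, continuous (pdx (pdx u))} /\ {for z, continuous (pdx (pdy u))} /\
    {for z, continuous (pdy (pdx u))} /\ {for z, continuous (pdy (pdy u))}.

Definition hclosure (R : realType) (D : set (R * R)) : set (R * R) :=
  closure D `&` @H2 R.
Definition hbdry (R : realType) (D : set (R * R)) : set (R * R) :=
  (closure D `\` D) `&` @H2 R.

Definition extends_cont (R : realType) (D : set (R * R)) (w g : R * R -> R) :=
  {within hclosure D, continuous g} /\ (forall z, D z -> g z = w z).

Definition C2_closure (R : realType) (D : set (R * R)) (u : R * R -> R) : Prop :=
  C2_on D u /\ {within hclosure D, continuous u} /\
  (exists g, extends_cont D (pdx u) g) /\ (exists g, extends_cont D (pdy u) g) /\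
  (exists g, extends_cont D (pdx (pdx u)) g) /\
  (exists g, extends_cont D (pdx (pdy u)) g) /\
  (exists g, extends_cont D (pdy (pdx u)) g) /\
  (exists g, extends_cont D (pdy (pdy u)) g).

Definition local_defining (R : realType) (D : set (R * R)) (z : R * R)
    (U : set (R * R)) (phi : R * R -> R) : Prop :=
  open U /\ U z /\ U `<=` @H2 R /\ C2_on U phi /\
  (forall w, U w -> (pdx phi w, pdy phi w) != (0, 0)) /\
  (forall w, U w -> (D w <-> phi w < 0)).

Definition C2_boundary (R : realType) (D : set (R * R)) : Prop :=
  forall z, hbdry D z -> exists U phi, local_defining D z U phi.

(* <grad u, nu> = a on the boundary of D, where nu is the outward unit normal
   (for the hyperbolic metric) and (gx, gy) are the continuous extensions of
   the Euclidean partial derivatives of u to the closure.  The Euclidean outward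
   unit normal at z is grad phi / |grad phi| for any local defining function
   phi; the hyperbolic unit normal is y times it, and
   <grad u, nu>_g = du(nu) = y * (gx nx + gy ny). *)
Definition normal_deriv_eq (R : realType) (D : set (R * R)) (u : R * R -> R)
    (a : R) : Prop :=
  exists gx gy, [/\ extends_cont D (pdx u) gx, extends_cont D (pdy u) gy &
    forall z U phi, hbdry D z -> local_defining D z U phi ->
      z.2 * (gx z * pdx phi z + gy z * pdy phi z)
        / Num.sqrt (pdx phi z ^+ 2 + pdy phi z ^+ 2) = a].

Definition leb2 (R : realType) := ((@lebesgue_measure R) \x (@lebesgue_measure R))%E.

Definition test_fun (R : realType) (D : set (R * R)) (phi : R * R -> R) : Prop :=
  [/\ C1_on setT phi, compact (closure [set z | phi z != 0]),
      closure [set z | phi z != 0] `<=` D & exists z, phi z != 0].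

(* first Dirichlet eigenvalue of the Laplace-Beltrami operator on D (D in H^2):
   infimum of the Rayleigh quotient  int |grad phi|_g^2 dvol / int phi^2 dvol.
   In the half-plane model |grad phi|_g^2 dvol = (phi_x^2 + phi_y^2) dx dy and
   dvol = dx dy / y^2. *)
Definition first_dirichlet_eig (R : realType) (D : set (R * R)) : R :=
  inf [set q : R | exists phi, test_fun D phi /\
     q = Rintegral (@leb2 R) D (fun z => pdx phi z ^+ 2 + pdy phi z ^+ 2)
         / Rintegral (@leb2 R) D (fun z => phi z ^+ 2 / z.2 ^+ 2)].

(* Main.v *)
(** The hypothesis on [f] gives [Delta u + lambda u <= 0]. Suppose that two points [x], [y] of the closure of a component of [u > h0] are at distance at
    least [2 R]. Slide the disc of radius [R], carrying a copy [v_c] of the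
    eigenfunction, with its centre [c] moving along the perpendicular bisector of
    [x y]. A compact connected set inside (essentially) [u > h0] joins the two sides
    of the strip swept by the discs, and cuts off an upper region [A] of it. For
    some [kappa > 1], [u > kappa v_c] on that set, because [v <= v(p) = h0] and [v_c]
    is small near the sides of the strip. The condition that [A] meets the disc
    inside [Omega], with [u >= kappa v_c] there, is closed in [c] by continuity and open by
    the maximum principle: [u - kappa v_c] is superharmonic, and the disc cannot
    reach the boundary of [Omega], where [u] has slope [- alpha] while [kappa v_c]
    has the larger slope [- kappa alpha]. It holds when the disc lies far below the
    separating set, hence also far above it; there a whole closed disc lies in
    [Omega], which is impossible by comparing [u] with the eigenfunction of that disc.
    The inequality [v <= v(p)] comes from reflections in geodesics. *)
Require Import Defs.
From HB Require Import structures.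
From mathcomp Require Import all_boot all_order all_algebra.
From mathcomp Require Import all_classical all_reals all_analysis.
From mathcomp Require Import ring lra.
Import Order.TTheory GRing.Theory Num.Theory.
Import numFieldNormedType.Exports.
Local Open Scope classical_set_scope.
Local Open Scope ring_scope.
Set Implicit Arguments. Unset Strict Implicit. Unset Printing Implicit Defensive.

(** Distances are handled through their hyperbolic cosine, which is rational in the coordinates:
    with [k] the cosine of the radius, the discs are [hcosh c z < k], the target is cosh (2 R) = 2
    k^2 - 1, and sinh R = sqrt (k^2 - 1) is the half-width of the swept strip. The factor kappa > 1
    stands in for the Hopf lemma: at a contact with the boundary of [Omega] the two slopes already
    differ at first order, so that a comparison along one ray decides. A diameter smaller than 2 R
    asks for one bound valid for all pairs; hence [x] and [y] range over the closure of the
    component, where only u >= h0 holds. If u = h0 there, height alone gives no kappa > 1; near the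
    sides of the strip u > h0 / 2 is accepted instead, since there v_c < h0 / 4 and kappa <= 2.
    Nothing is known about the symmetry of [v], so its copies are carried by one explicit isometry
    for each centre, continuous in the centre. The topology of the plane enters through the parity
    of crossings with vertical rays, in place of the Jordan curve theorem. *)

Section differential_calculus.
Context {R : realType}.
Implicit Types (u w : R * R -> R) (z : R * R).

(** * Directional derivatives, chain rule, and the Laplacian of a composition *)

Section pointwise_rules.
Context {V : normedModType R}.
Implicit Types (f g : V -> R) (x d : V).

Lemma is_derive_add f g x d (f' g' : R) : is_derive x d f f' -> is_derive x d g g' ->
  is_derive x d (fun y => f y + g y) (f' + g').
Proof. by move=> hf hg; exact: is_deriveD. Qed.

Lemma is_derive_opp f x d (f' : R) : is_derive x d f f' ->
  is_derive x d (fun y => - f y) (- f').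
Proof. by move=> hf; exact: is_deriveN. Qed.

Lemma is_derive_mul f g x d (f' g' : R) : is_derive x d f f' -> is_derive x d g g' ->
  is_derive x d (fun y => f y * g y) (f x * g' + g x * f').
Proof. by move=> hf hg; exact: is_deriveM. Qed.

Lemma is_derive_const (c : R) x d : is_derive x d (fun _ : V => c) 0.
Proof. exact: is_derive_cst. Qed.

Lemma is_derive_sqr f x d (f' : R) : is_derive x d f f' ->
  is_derive x d (fun y => f y ^+ 2) (2 * f x * f').
Proof.
by move=> hf; apply: is_derive_eq (is_derive_mul hf hf) _; ring.
Qed.

Lemma is_derive_inv f x d (f' : R) : f x != 0 -> is_derive x d f f' ->
  is_derive x d (fun y => (f y)^-1) (- f' / f x ^+ 2).
Proof.
move=> f0 hf; apply: DeriveDef; first exact: derivableV.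
rewrite deriveV// derive_val /GRing.scale/=; field.
by rewrite f0.
Qed.

Lemma diff_is_derive f x d : differentiable f x -> is_derive x d f ('D_d f x).
Proof. by move=> df; exact/derivableP/diff_derivable. Qed.

Lemma near_differentiable f g x : (\near x, f x = g x) ->
  differentiable f x -> differentiable g x.
Proof.
move=> fg df.
have gx : f x = g x := nbhs_singleton fg.
have h : g \o shift x = cst (g x) + 'd f x +o_ 0 id.
  apply: eqaddoE; apply/eqaddoP => e e0.
  have /eqaddoP/(_ e e0) H := diff_locally df.
  have fg0 : \forall h \near (0 : V), f (h + x) = g (h + x).
    by have := fg; rewrite (near_shift 0) subr0.
  apply: filterS2 H fg0 => h /=.
  by rewrite /cst/= !fctE /= => + fgh; rewrite fgh gx.
apply/diff_locallyP; rewrite (diff_unique _ h); last exact: diff_continuous.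
by split=> //; exact: diff_continuous.
Unshelve. all: by end_near. Qed.

End pointwise_rules.

Lemma is_derive_fst z (d : R * R) : is_derive z d (fun y : R * R => y.1) d.1.
Proof.
have H : differentiable (fst : R * R -> R) z.
  by apply: linear_differentiable => y; exact: cvg_fst.
apply: DeriveDef; first exact: diff_derivable.
by rewrite deriveE// diff_lin// => y; exact: cvg_fst.
Qed.

Lemma is_derive_snd z (d : R * R) : is_derive z d (fun y : R * R => y.2) d.2.
Proof.
have H : differentiable (snd : R * R -> R) z.
  by apply: linear_differentiable => y; exact: cvg_snd.
apply: DeriveDef; first exact: diff_derivable.
by rewrite deriveE// diff_lin// => y; exact: cvg_snd.
Qed.

Lemma differentiable_fst z : differentiable (fun y : R * R => y.1) z.
Proof. by apply: (@linear_differentiable _ _ _ fst) => y; exact: cvg_fst. Qed.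

Lemma differentiable_snd z : differentiable (fun y : R * R => y.2) z.
Proof. by apply: (@linear_differentiable _ _ _ snd) => y; exact: cvg_snd. Qed.

Lemma derive_pdE u z (d : R * R) : differentiable u z ->
  'D_d u z = d.1 * pdx u z + d.2 * pdy u z.
Proof.
move=> du; rewrite /pdx /pdy !deriveE//.
have -> : d = d.1 *: ((1, 0) : R * R) + d.2 *: ((0, 1) : R * R).
  case: d => a b; congr pair; rewrite /= /GRing.scale/=; ring.
rewrite linearD !linearZ/= /GRing.scale/=; congr (_ * _ + _ * _); ring.
Qed.

Lemma is_derive_comp2 {V : normedModType R} u (s1 s2 : V -> R) (x d : V) (d1 d2 : R) :
  differentiable s1 x -> differentiable s2 x ->
  differentiable u (s1 x, s2 x) ->
  is_derive x d s1 d1 -> is_derive x d s2 d2 ->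
  is_derive x d (fun y => u (s1 y, s2 y))
    (d1 * pdx u (s1 x, s2 x) + d2 * pdy u (s1 x, s2 x)).
Proof.
move=> h1 h2 hu i1 i2.
have hp := differentiable_pair h1 h2.
have hc : differentiable (u \o (fun y => (s1 y, s2 y))) x.
  exact: differentiable_comp.
apply: DeriveDef; first exact: diff_derivable.
rewrite deriveE// [X in 'd X x]/(u \o (fun y => (s1 y, s2 y))) diff_comp//= diff_pair//.
by rewrite -!deriveE// derive_pdE// !derive_val.
Qed.

Lemma is_derive_curve u (a b : R -> R) (t a' b' : R) :
  differentiable u (a t, b t) -> is_derive t 1 a a' -> is_derive t 1 b b' ->
  is_derive t 1 (fun s => u (a s, b s)) (a' * pdx u (a t, b t) + b' * pdy u (a t, b t)).
Proof.
move=> du ha hb; apply: is_derive_comp2 => //.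
- by apply/derivable1_diffP; case: ha.
- by apply/derivable1_diffP; case: hb.
Qed.

(** What a second-order chain rule consumes: the first partials of a composition are computed on a
    neighbourhood, where [u] must be differentiable, and are then differentiated once at the point
    itself. *)
Definition D2 u z := [/\ \forall y \near z, differentiable u y,
  differentiable (pdx u) z & differentiable (pdy u) z].

Definition lap u z := pdx (pdx u) z + pdy (pdy u) z.

Lemma hlapE u z : hlap u z = z.2 ^+ 2 * lap u z.
Proof. by []. Qed.

Lemma C2_on_D2 (D : set (R * R)) u z : open D -> C2_on D u -> D z -> D2 u z.
Proof.
move=> oD h Dz; split; last 2 first.
- by have [_ []] := h z Dz.
- by have [_ [_ []]] := h z Dz.
apply: filterS (open_nbhs_nbhs (conj oD Dz)) => y Dy.
by have [] := h y Dy.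
Qed.

Lemma D2_differentiable {u z} : D2 u z -> differentiable u z.
Proof. by case=> /nbhs_singleton. Qed.

Lemma D2_continuous {u z} : D2 u z -> {for z, continuous u}.
Proof. by move=> /D2_differentiable /differentiable_continuous. Qed.

Lemma near_eq_pdx u w z : (\near z, u z = w z) -> pdx u z = pdx w z.
Proof. exact: near_eq_derive. Qed.

Lemma near_eq_pdy u w z : (\near z, u z = w z) -> pdy u z = pdy w z.
Proof. exact: near_eq_derive. Qed.

Section composition.
Variables (u s1 s2 : R * R -> R) (z : R * R).
Let s y := (s1 y, s2 y).
Hypotheses (hu : D2 u (s z)) (h1 : D2 s1 z) (h2 : D2 s2 z).

Let near_all : \forall y \near z,
  [/\ differentiable s1 y, differentiable s2 y & differentiable u (s y)].
Proof.
have cs : {for z, continuous s}.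
  apply: differentiable_continuous.
  by apply: differentiable_pair; exact: D2_differentiable.
have nu : \forall y \near z, differentiable u (s y).
  by have [nu _ _] := hu; exact: cs nu.
have [n1 _ _] := h1; have [n2 _ _] := h2.
by near=> y; split; near: y.
Unshelve. all: by end_near. Qed.

Let pdx_comp : \forall y \near z, pdx (u \o s) y =
  pdx s1 y * pdx u (s y) + pdx s2 y * pdy u (s y).
Proof.
near=> y; have [a b c] : [/\ differentiable s1 y, differentiable s2 y &
  differentiable u (s y)] by near: y; exact: near_all.
by rewrite {1}/pdx (@derive_val _ _ _ _ _ _ _
  (is_derive_comp2 a b c (diff_is_derive _ a) (diff_is_derive _ b))).
Unshelve. all: by end_near. Qed.

Let pdy_comp : \forall y \near z, pdy (u \o s) y =
  pdy s1 y * pdx u (s y) + pdy s2 y * pdy u (s y).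
Proof.
near=> y; have [a b c] : [/\ differentiable s1 y, differentiable s2 y &
  differentiable u (s y)] by near: y; exact: near_all.
by rewrite {1}/pdy (@derive_val _ _ _ _ _ _ _
  (is_derive_comp2 a b c (diff_is_derive _ a) (diff_is_derive _ b))).
Unshelve. all: by end_near. Qed.

Let d_s : differentiable s z.
Proof. by apply: differentiable_pair; exact: D2_differentiable. Qed.

Lemma D2_comp : D2 (u \o s) z.
Proof.
have [_ ux uy] := hu; have [_ s1x s1y] := h1; have [_ s2x s2y] := h2.
split.
- near=> y; have [a b c] : [/\ differentiable s1 y, differentiable s2 y &
    differentiable u (s y)] by near: y; exact: near_all.
  by apply: differentiable_comp => //; exact: differentiable_pair.
- apply: (@near_differentiable _ (fun y => pdx s1 y * (pdx u \o s) y + pdx s2 y * (pdy u \o s) y)).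
    by apply: filterS pdx_comp => y /= ->.
  by apply: differentiableD; apply: differentiableM => //;
     apply: differentiable_comp.
- apply: (@near_differentiable _ (fun y => pdy s1 y * (pdx u \o s) y + pdy s2 y * (pdy u \o s) y)).
    by apply: filterS pdy_comp => y /= ->.
  by apply: differentiableD; apply: differentiableM => //;
     apply: differentiable_comp.
Unshelve. all: by end_near. Qed.

(** The hypotheses say that [s] is conformal or anticonformal with harmonic components, which covers
    reflections. The mixed second derivatives of [u] appear only with the scalar product of the two
    gradients as factor, which is 0. *)
Lemma lap_conformal (m : R) :
  pdx s1 z * pdx s2 z + pdy s1 z * pdy s2 z = 0 ->
  pdx s1 z ^+ 2 + pdy s1 z ^+ 2 = m -> pdx s2 z ^+ 2 + pdy s2 z ^+ 2 = m ->
  lap s1 z = 0 -> lap s2 z = 0 -> lap (u \o s) z = m * lap u (s z).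
Proof.
have [_ ux uy] := hu; have [_ s1x s1y] := h1; have [_ s2x s2y] := h2.
have d1 := D2_differentiable h1; have d2 := D2_differentiable h2.
rewrite /lap (near_eq_pdx pdx_comp) (near_eq_pdy pdy_comp).
have D (f : R * R -> R) d : differentiable f z -> is_derive z d f ('D_d f z) by exact: diff_is_derive.
have I (f : R * R -> R) d : differentiable f (s z) ->
  is_derive z d (fun y => f (s1 y, s2 y))
    ('D_d s1 z * pdx f (s z) + 'D_d s2 z * pdy f (s z)).
  by move=> df; exact: is_derive_comp2 (D _ _ d1) (D _ _ d2).
have X : pdx (fun y => pdx s1 y * pdx u (s y) + pdx s2 y * pdy u (s y)) z =
  pdx s1 z * (pdx s1 z * pdx (pdx u) (s z) + pdx s2 z * pdy (pdx u) (s z)) +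
    pdx u (s z) * pdx (pdx s1) z +
  (pdx s2 z * (pdx s1 z * pdx (pdy u) (s z) + pdx s2 z * pdy (pdy u) (s z)) +
    pdy u (s z) * pdx (pdx s2) z).
  apply: (@derive_val _ _ _ _ _ _ _ (is_derive_add
    (is_derive_mul (D _ _ s1x) (I _ _ ux)) (is_derive_mul (D _ _ s2x) (I _ _ uy)))).
have Y : pdy (fun y => pdy s1 y * pdx u (s y) + pdy s2 y * pdy u (s y)) z =
  pdy s1 z * (pdy s1 z * pdx (pdx u) (s z) + pdy s2 z * pdy (pdx u) (s z)) +
    pdx u (s z) * pdy (pdy s1) z +
  (pdy s2 z * (pdy s1 z * pdx (pdy u) (s z) + pdy s2 z * pdy (pdy u) (s z)) +
    pdy u (s z) * pdy (pdy s2) z).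
  apply: (@derive_val _ _ _ _ _ _ _ (is_derive_add
    (is_derive_mul (D _ _ s1y) (I _ _ ux)) (is_derive_mul (D _ _ s2y) (I _ _ uy)))).
rewrite X Y.
move: (pdx s1 z) (pdy s1 z) (pdx s2 z) (pdy s2 z) (pdx (pdx s1) z)
  (pdy (pdy s1) z) (pdx (pdx s2) z) (pdy (pdy s2) z) (pdx (pdx u) (s z))
  (pdy (pdx u) (s z)) (pdx (pdy u) (s z)) (pdy (pdy u) (s z)) (pdx u (s z))
  (pdy u (s z)) => a b c d e f g h A B C E F G H1 H2 H3 H4 H5.
have -> : a * (a * A + c * B) + F * e + (c * (a * C + c * E) + G * g) +
  (b * (b * A + d * B) + F * f + (d * (b * C + d * E) + G * h)) =
  (a ^+ 2 + b ^+ 2) * A + (c ^+ 2 + d ^+ 2) * E + (a * c + b * d) * (B + C) +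
  F * (e + f) + G * (g + h) by ring.
rewrite H1 H2 H3 H4 H5; ring.
Qed.

End composition.

Lemma D2_lin u w (a b : R) z : D2 u z -> D2 w z ->
  D2 (fun y => a * u y + b * w y) z /\
  lap (fun y => a * u y + b * w y) z = a * lap u z + b * lap w z.
Proof.
move=> [nu ux uy] [nw wx wy].
have D (f : R * R -> R) y d : differentiable f y -> is_derive y d f ('D_d f y).
  exact: diff_is_derive.
have L (f g : R * R -> R) y d : differentiable f y -> differentiable g y ->
    'D_d (fun y => a * f y + b * g y) y = a * 'D_d f y + b * 'D_d g y.
  move=> df dg.
  have := is_derive_add (is_derive_mul (is_derive_const a y d) (D _ _ d df))
     (is_derive_mul (is_derive_const b y d) (D _ _ d dg)).
  by move/@derive_val => ->; ring.
have Ld (f g : R * R -> R) y : differentiable f y -> differentiable g y ->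
    differentiable (fun y => a * f y + b * g y) y.
  by move=> df dg; apply: differentiableD; apply: differentiableM.
have Lx : \forall y \near z, a * pdx u y + b * pdx w y = pdx (fun y => a * u y + b * w y) y.
  near=> y; rewrite /pdx L//; near: y; [exact: nu|exact: nw].
have Ly : \forall y \near z, a * pdy u y + b * pdy w y = pdy (fun y => a * u y + b * w y) y.
  near=> y; rewrite /pdy L//; near: y; [exact: nu|exact: nw].
split; first split.
- by near=> y; apply: Ld; near: y.
- exact: near_differentiable Lx (Ld _ _ _ ux wx).
- exact: near_differentiable Ly (Ld _ _ _ uy wy).
have Ex : pdx (fun y => a * pdx u y + b * pdx w y) z =
  a * pdx (pdx u) z + b * pdx (pdx w) z by exact: L.
have Ey : pdy (fun y => a * pdy u y + b * pdy w y) z =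
  a * pdy (pdy u) z + b * pdy (pdy w) z by exact: L.
rewrite /lap -(near_eq_pdx Lx) -(near_eq_pdy Ly) Ex Ey.
move: (pdx (pdx u) z) (pdx (pdx w) z) (pdy (pdy u) z) (pdy (pdy w) z) => A B C D'.
by rewrite !mulrDr addrACA.
Unshelve. all: by end_near. Qed.

End differential_calculus.

(** * Continuity and differentiability at a point, decided by syntax *)

Section pointwise_continuity.
Context {R : realType} {T : topologicalType}.
Implicit Types (f g : T -> R) (x : T).

Lemma cont_add f g x : {for x, continuous f} -> {for x, continuous g} ->
  {for x, continuous (fun y => f y + g y)}.
Proof. by move=> hf hg; exact: cvgD. Qed.

Lemma cont_opp f x : {for x, continuous f} -> {for x, continuous (fun y => - f y)}.
Proof. by move=> hf; exact: cvgN. Qed.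

Lemma cont_mul f g x : {for x, continuous f} -> {for x, continuous g} ->
  {for x, continuous (fun y => f y * g y)}.
Proof. by move=> hf hg; exact: cvgM. Qed.

Lemma cont_sqr f x : {for x, continuous f} -> {for x, continuous (fun y => f y ^+ 2)}.
Proof. by move=> hf; exact: cvgM. Qed.

Lemma cont_inv f x : f x != 0 -> {for x, continuous f} ->
  {for x, continuous (fun y => (f y)^-1)}.
Proof. by move=> f0 hf; exact: cvgV. Qed.

Lemma cont_cst (U : topologicalType) (c : U) x : {for x, continuous (fun _ : T => c)}.
Proof. exact: cvg_cst. Qed.

Lemma cont_fst (U V : topologicalType) (h : T -> U * V) x : {for x, continuous h} ->
  {for x, continuous (fun y => (h y).1)}.
Proof. by move=> hh; apply: (cvg_comp _ _ hh); exact: cvg_fst. Qed.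

Lemma cont_snd (U V : topologicalType) (h : T -> U * V) x : {for x, continuous h} ->
  {for x, continuous (fun y => (h y).2)}.
Proof. by move=> hh; apply: (cvg_comp _ _ hh); exact: cvg_snd. Qed.

Lemma cont_pair (U V : topologicalType) (h : T -> U) (k : T -> V) x :
  {for x, continuous h} -> {for x, continuous k} ->
  {for x, continuous (fun y => (h y, k y))}.
Proof. by move=> hh hk; exact: (cvg_pair hh hk). Qed.

Lemma cont_id x : {for x, continuous (fun y : T => y)}.
Proof. exact: cvg_id. Qed.

Lemma continuous_pointwise f : (forall x, {for x, continuous f}) -> continuous f.
Proof. by []. Qed.

Lemma cont_lt f g x : {for x, continuous f} -> {for x, continuous g} ->
  f x < g x -> \forall y \near x, f y < g y.
Proof.
move=> hf hg fg.
have h : {for x, continuous (fun y => g y - f y)} by apply: cont_add => //; exact: cont_opp.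
have := h [set t | 0 < t] (open_nbhs_nbhs (conj (@open_gt R 0) _)).
rewrite /= subr_gt0 => /(_ fg) /= H.
by near=> y; rewrite -subr_gt0; near: y.
Unshelve. all: by end_near. Qed.

Lemma closed_nonneg f : continuous f -> closed [set y | 0 <= f y].
Proof. by move=> /continuous_closedP h; exact: (h _ (@closed_ge R 0)). Qed.

Lemma closed_zero f : continuous f -> closed [set y | f y = 0].
Proof. by move=> /continuous_closedP h; exact: (h _ (@closed_eq R 0)). Qed.

End pointwise_continuity.

(** The body is matched syntactically and its pieces are passed explicitly, so that higher-order
    unification has nothing to guess. Nonvanishing of denominators is left as a goal. *)
Ltac cont_rule f :=
  lazymatch f with
  | (fun _ => ?c) => exact: cont_cst
  | (fun y => y) => exact: cont_id
  | fst => exact: (cont_fst (@cont_id _ _))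
  | snd => exact: (cont_snd (@cont_id _ _))
  | (fun y => (@?g y + @?h y)%R) => apply: (@cont_add _ _ g h)
  | (fun y => (- @?g y)%R) => apply: (@cont_opp _ _ g)
  | (fun y => (@?g y * @?h y)%R) => apply: (@cont_mul _ _ g h)
  | (fun y => ((@?g y)^-1)%R) => apply: (@cont_inv _ _ g)
  | (fun y => (@?g y ^+ 2)%R) => apply: (@cont_sqr _ _ g)
  | (fun y => (@?g y, @?h y)) => apply: (@cont_pair _ _ _ g h)
  | (fun y => (@?g y).1) => apply: (@cont_fst _ _ _ g)
  | (fun y => (@?g y).2) => apply: (@cont_snd _ _ _ g)
  end.
Ltac cont := repeat first [ assumption |
  lazymatch goal with
  | |- {for _, continuous ?f} => cont_rule f
  | |- continuous_at _ ?f => cont_rule f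
  end ].

Section pointwise_differentiability.
Context {R : realType} {V : normedModType R}.
Implicit Types (f g : V -> R) (x : V).

Lemma dif_add f g x : differentiable f x -> differentiable g x ->
  differentiable (fun y => f y + g y) x.
Proof. exact: differentiableD. Qed.

Lemma dif_opp f x : differentiable f x -> differentiable (fun y => - f y) x.
Proof. exact: differentiableN. Qed.

Lemma dif_mul f g x : differentiable f x -> differentiable g x ->
  differentiable (fun y => f y * g y) x.
Proof. exact: differentiableM. Qed.

Lemma dif_sqr f x : differentiable f x -> differentiable (fun y => f y ^+ 2) x.
Proof. by move=> df; exact: differentiableM. Qed.

Lemma dif_inv f x : f x != 0 -> differentiable f x ->
  differentiable (fun y => (f y)^-1) x.
Proof. by move=> f0 df; exact: differentiableV. Qed.

Lemma dif_cst (c : R) x : differentiable (fun _ : V => c) x.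
Proof. exact: differentiable_cst. Qed.

End pointwise_differentiability.

Ltac dif := repeat first
  [ exact: dif_cst | exact: differentiable_fst | exact: differentiable_snd
  | assumption | apply: dif_add | apply: dif_opp
  | apply: dif_sqr | apply: dif_mul | apply: dif_inv ].

(** * Strong maximum principle for the flat Laplacian *)

Section maximum_principle.
Context {R : realType}.
Implicit Types (w : R * R -> R) (z : R * R).

(** At the minimum [h'] vanishes; if [l < 0] it is negative just to the right, and the mean value
    theorem makes [h] drop below its minimum. *)
Lemma second_deriv_ge0 (h h' : R -> R) (x l : R) :
  (\forall t \near x, is_derive (t : R) (1 : R) h (h' t)) -> is_derive x 1 h' l ->
  (\forall t \near x, h x <= h t) -> 0 <= l.
Proof.
move=> dh dh' hmin; rewrite leNgt; apply/negP => l0.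
have [e /= e0 he] : \forall t \near x, is_derive (t : R) (1 : R) h (h' t) /\ h x <= h t.
  by near=> t; split; near: t.
have ball_in t : `|t - x| < e -> is_derive (t : R) (1 : R) h (h' t) /\ h x <= h t.
  by move=> te; apply: he => /=; rewrite distrC.
have h'x : h' x = 0.
  have Dx : is_derive x 1 h 0.
    apply: (@derive1_at_min _ h (x - e) (x + e)).
    - lra.
    - move=> t; rewrite in_itv/= => /andP[t1 t2].
      have [] := ball_in t; last by [].
      by rewrite ltr_norml; apply/andP; split; lra.
    - by rewrite in_itv/=; apply/andP; split; lra.
    - move=> t; rewrite in_itv/= => /andP[t1 t2].
      have [] := ball_in t; last by [].
      by rewrite ltr_norml; apply/andP; split; lra.
  have Dx' : is_derive x 1 h (h' x).
    by have [] := ball_in x; rewrite // subrr normr0.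
  by rewrite -(@derive_val _ _ _ _ _ _ _ Dx') (@derive_val _ _ _ _ _ _ _ Dx).
have dl : (s^-1 *: ((h' \o shift x) (s *: 1) - h' x)) @[s --> 0^'] --> l.
  by have [+ <-] := dh'; exact.
have [d /= d0 hd] : \forall s \near 0^', s^-1 * h' (s + x) < 0.
  have := dl [set t | t < 0] (open_nbhs_nbhs (conj (@open_lt R 0) l0)).
  rewrite !near_simpl /= => H; near=> s.
  have : s^-1 *: (h' (s *: 1 + x) - h' x) < 0 by near: s.
  by rewrite h'x subr0 [s *: 1]mulr1.
pose m := Num.min d e / 2.
have m0 : 0 < m by rewrite /m divr_gt0// lt_min d0 e0.
have [md me] : m < d /\ m < e.
  have : Num.min d e <= d by rewrite ge_min lexx.
  have : Num.min d e <= e by rewrite ge_min lexx orbT.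
  rewrite /m => ? ?; split; lra.
have [|||c] := @MVT _ h h' x (x + m).
- lra.
- move=> t; rewrite in_itv/= => /andP[t1 t2].
  have [] := ball_in t; last by [].
  by rewrite ltr_norml; apply/andP; split; lra.
- apply: derivable_within_continuous => t; rewrite in_itv/= => /andP[t1 t2].
  have [] := ball_in t; last by [].
  by rewrite ltr_norml; apply/andP; split; lra.
rewrite in_itv/= => /andP[c1 c2] E.
have h'c : h' c < 0.
  have cx : 0 < c - x by lra.
  have := hd (c - x); rewrite /= sub0r normrN subrK gtr0_norm//.
  rewrite pmulr_rlt0 ?invr_gt0//; apply; first lra.
  by rewrite gt_eqF.
have [_ ] : is_derive (x + m) 1 h (h' (x + m)) /\ h x <= h (x + m).
  by apply: ball_in; rewrite addrC addKr gtr0_norm.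
nra.
Unshelve. all: by end_near. Qed.

Lemma is_derive_horizontal w (a b : R) : differentiable w (a, b) ->
  is_derive a 1 (fun t => w (t, b)) (pdx w (a, b)).
Proof.
move=> dw; have E (A B : R) : 1 * A + 0 * B = A by ring.
exact: is_derive_eq (is_derive_curve (a := id) (b := fun => b) dw
  (is_derive_id _ _) (is_derive_cst _ _ _)) (E _ _).
Qed.

Lemma is_derive_vertical w (a b : R) : differentiable w (a, b) ->
  is_derive b 1 (fun t => w (a, t)) (pdy w (a, b)).
Proof.
move=> dw; have E (A B : R) : 0 * A + 1 * B = B by ring.
exact: is_derive_eq (is_derive_curve (a := fun => a) (b := id) dw
  (is_derive_cst _ _ _) (is_derive_id _ _)) (E _ _).
Qed.

Lemma lap_min w z : D2 w z -> (\forall y \near z, w z <= w y) -> 0 <= lap w z.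
Proof.
move=> [nw wx wy] hmin.
have cx : {for z.1, continuous (fun t : R => (t, z.2))} by cont.
have cy : {for z.2, continuous (fun t : R => (z.1, t))} by cont.
rewrite (surjective_pairing z) in nw hmin.
apply: addr_ge0.
- apply: (@second_deriv_ge0 (fun t => w (t, z.2)) (fun t => pdx w (t, z.2)) z.1).
  + near=> t; apply: is_derive_horizontal.
    by near: t; exact: cx nw.
  + have := @is_derive_horizontal (pdx w) z.1 z.2.
    by rewrite -!surjective_pairing => /(_ wx).
  + exact: cx hmin.
- apply: (@second_deriv_ge0 (fun t => w (z.1, t)) (fun t => pdy w (z.1, t)) z.2).
  + near=> t; apply: is_derive_vertical.
    by near: t; exact: cy nw.
  + have := @is_derive_vertical (pdy w) z.1 z.2.
    by rewrite -!surjective_pairing => /(_ wy).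
  + exact: cy hmin.
Unshelve. all: by end_near. Qed.

(** The linear term makes the zero set pass vertically through [z], the term [- (y.2 - z.2) ^+ 2]
    bends it to the right, and the coefficient 2 keeps the Laplacian positive: 4 - 2 = 2. For
    horizontal distances below 1/2 the polynomial is negative at every point on the left of [z] and
    on the vertical line through [z], except at [z]. *)
Definition probe (z y : R * R) : R :=
  (y.1 - z.1) + 2 * (y.1 - z.1) ^+ 2 - (y.2 - z.2) ^+ 2.

Lemma probe_continuous z : continuous (probe z).
Proof. by apply: continuous_pointwise => y; rewrite /probe; cont. Qed.

Lemma probe_D2 z y : D2 (probe z) y /\ lap (probe z) y = 2.
Proof.
have dp x : differentiable (probe z) x.
  by rewrite /probe; dif.
have Dp x d : is_derive x d (probe z)
    (d.1 + 4 * (x.1 - z.1) * d.1 - 2 * (x.2 - z.2) * d.2).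
  have h1 := is_derive_add (is_derive_fst x d) (is_derive_const (- z.1) x d).
  have h2 := is_derive_add (is_derive_snd x d) (is_derive_const (- z.2) x d).
  apply: is_derive_eq (is_derive_add (is_derive_add h1
    (is_derive_mul (is_derive_const 2 x d) (is_derive_sqr h1)))
    (is_derive_opp (is_derive_sqr h2))) _; ring.
have Ex : pdx (probe z) = fun x => 4 * x.1 + (1 - 4 * z.1).
  apply/funext => x; rewrite /pdx (@derive_val _ _ _ _ _ _ _ (Dp x _))/=; ring.
have Ey : pdy (probe z) = fun x => - 2 * x.2 + 2 * z.2.
  apply/funext => x; rewrite /pdy (@derive_val _ _ _ _ _ _ _ (Dp x _))/=; ring.
have L1 := is_derive_add (is_derive_mul (is_derive_const 4 y (1, 0))
  (is_derive_fst y (1, 0))) (is_derive_const (1 - 4 * z.1) y (1, 0)).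
have L2 := is_derive_add (is_derive_mul (is_derive_const (- 2) y (0, 1))
  (is_derive_snd y (0, 1))) (is_derive_const (2 * z.2) y (0, 1)).
split.
  split; first by near=> x; exact: dp.
  - by rewrite Ex; dif.
  - by rewrite Ey; dif.
rewrite /lap Ex Ey /pdx /pdy (@derive_val _ _ _ _ _ _ _ L1).
rewrite (@derive_val _ _ _ _ _ _ _ L2)/=; ring.
Unshelve. all: by end_near. Qed.

Definition box (z : R * R) (r : R) : set (R * R) :=
  `[z.1 - r, z.1 + r]%classic `*` `[z.2 - r, z.2 + r]%classic.

Lemma boxP z r y : box z r y <->
  [/\ z.1 - r <= y.1, y.1 <= z.1 + r, z.2 - r <= y.2 & y.2 <= z.2 + r].
Proof.
rewrite /box /= !in_itv/=; split; first by move=> [/andP[? ?] /andP[? ?]].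
by move=> [-> -> -> ->].
Qed.

Lemma box_compact z r : compact (box z r).
Proof. by apply: compact_setX; exact: segment_compact. Qed.

Lemma nbhs_box z (A : set (R * R)) : nbhs z A ->
  exists2 r : R, 0 < r & forall y, box z r y -> A y.
Proof.
move=> /nbhs_ballP[e /= e0 he]; exists (e / 2); first by rewrite divr_gt0.
move=> y /boxP[a b c d]; apply: he; split; rewrite /ball/= ltr_norml;
  apply/andP; split; lra.
Qed.

Lemma box_nbhs z r y : z.1 - r < y.1 -> y.1 < z.1 + r -> z.2 - r < y.2 ->
  y.2 < z.2 + r -> \forall x \near y, box z r x.
Proof.
move=> a b c d.
have L (f g : R * R -> R) : {for y, continuous f} -> {for y, continuous g} ->
  f y < g y -> \forall x \near y, f x < g x by exact: cont_lt.
near=> x; apply/boxP; split; apply: ltW; near: x.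
- by apply: (L (fun=> z.1 - r) fst); [cont|cont|exact: a].
- by apply: (L fst (fun=> z.1 + r)); [cont|cont|exact: b].
- by apply: (L (fun=> z.2 - r) snd); [cont|cont|exact: c].
- by apply: (L snd (fun=> z.2 + r)); [cont|cont|exact: d].
Unshelve. all: by end_near. Qed.

(* At the rightmost zero [z] of [w] the polynomial [probe z] is negative on the
   part of a small box boundary where [w] may vanish, so [w - m * probe z] has an
   interior minimum although its Laplacian is negative. *)
Lemma superharmonic_pos (O : set (R * R)) w : open O ->
  (forall z, O z -> [/\ D2 w z, lap w z <= 0 & 0 <= w z]) ->
  compact [set z | O z /\ w z = 0] -> forall z, O z -> 0 < w z.
Proof.
move=> oO hw cZ z0 Oz0; have [_ _ w0] := hw _ Oz0.
rewrite lt_neqAle w0 andbT; apply/negP => /eqP wz0.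
have [||z zZ zmax] := @compact_EVT_max _ R fst [set z | O z /\ w z = 0] _ cZ.
- by exists z0; split.
- by apply/continuous_subspaceT/continuous_pointwise => y; cont.
move: zZ; rewrite inE => -[Oz wz].
have {}zmax y : O y -> w y = 0 -> y.1 <= z.1.
  by move=> Oy wy; apply: zmax; rewrite inE.
have [r0 r00 hr0] := nbhs_box (open_nbhs_nbhs (conj oO Oz)).
pose r := Num.min r0 (1 / 4).
have r_gt0 : 0 < r by rewrite /r lt_min r00 /= divr_gt0.
have rle : r <= 1 / 4 by rewrite /r ge_min lexx orbT.
have rr0 : r <= r0 by rewrite /r ge_min lexx.
have BO y : box z r y -> O y.
  by move=> /boxP[? ? ? ?]; apply: hr0; apply/boxP; split; lra.
(* Inside the box, [g] vanishes exactly on the boundary, so that [P] is the part of the boundary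
   where [probe z] is nonnegative; it lies strictly to the right of [z], where [w] has no zero. *)
pose g (y : R * R) := ((y.1 - z.1) ^+ 2 - r ^+ 2) * ((y.2 - z.2) ^+ 2 - r ^+ 2).
pose P := box z r `&` ([set y | g y = 0] `&` [set y | 0 <= probe z y]).
have cw : {within box z r, continuous w}.
  apply: continuous_in_subspaceT => y; rewrite inE => /BO Oy.
  by have [D _ _] := hw _ Oy; exact: D2_continuous.
have cP : compact P.
  apply: compact_closedI; first exact: box_compact.
  apply: closedI; first by apply/closed_zero/continuous_pointwise => y; rewrite /g; cont.
  by apply: closed_nonneg; exact: probe_continuous.
have wP y : P y -> 0 < w y.
  move=> [By [gy py]]; have Oy := BO _ By; have [_ _ wy] := hw _ Oy.
  rewrite lt_neqAle wy andbT; apply/negP => /eqP /esym /(zmax _ Oy) yz.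
  move/boxP: By => [b1 b2 b3 b4]; move: gy py; rewrite /g /probe /=.
  move=> /eqP; rewrite mulf_eq0 => /orP[] /eqP H; nra.
have [m m0 mP] : exists2 m : R, 0 < m & forall y, P y -> m <= w y.
  have [P0|nP] := pselect (P !=set0); last first.
    by exists 1 => // y Py; exfalso; apply: nP; exists y.
  have [|c cP' cmin] := @compact_EVT_min _ R w P P0 cP.
    by apply: continuous_subspaceW cw => y [].
  exists (w c); first by apply: wP; rewrite inE in cP'.
  by move=> y Py; apply: cmin; rewrite inE.
pose F y := 1 * w y + (- m) * probe z y.
have BZ : box z r z by apply/boxP; split; lra.
have Fz : F z = 0 by rewrite /F wz /probe; ring.
have [||y yB ymin] := @compact_EVT_min _ R F (box z r) _ (@box_compact z r).
- by exists z.
- apply: continuous_in_subspaceT => y; rewrite inE => /BO Oy.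
  have [/D2_continuous cy _ _] := hw _ Oy; have py := @probe_continuous z y.
  by rewrite /F; apply: (@cont_add _ _ (fun y => 1 * w y)); apply: cont_mul => //;
    exact: cont_cst.
have {}ymin x : box z r x -> F y <= F x by move=> xB; apply: ymin; rewrite inE.
have {yB} yB : box z r y by rewrite inE in yB.
have Fy0 : F y <= 0 by rewrite -Fz; exact: ymin.
have E (L : R) : L <= 0 -> 0 <= 1 * L + - m * 2 -> False.
  by clear -m0 => ? ?; lra.
have noint x : box z r x -> (forall y, box z r y -> F x <= F y) -> g x = 0.
  move=> xB xmin; apply: contrapT => gx.
  have [x1 x2] : (x.1 - z.1) ^+ 2 < r ^+ 2 /\ (x.2 - z.2) ^+ 2 < r ^+ 2.
    have : (x.1 - z.1) ^+ 2 - r ^+ 2 != 0 /\ (x.2 - z.2) ^+ 2 - r ^+ 2 != 0.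
      by move/eqP: gx; rewrite mulf_eq0 negb_or => /andP[].
    rewrite !subr_eq0 => -[n1 n2].
    move/boxP: (xB) => [b1 b2 b3 b4].
    by rewrite !lt_neqAle n1 n2; split; nra.
  have nx : \forall t \near x, box z r t by apply: box_nbhs; nra.
  have [D lw _] := hw _ (BO _ xB); have [Dp lp] := probe_D2 z x.
  have [DF lF] := D2_lin 1 (- m) D Dp.
  apply: (E _ lw); rewrite -lp -lF; apply: (lap_min DF).
  by apply: filterS nx => t /xmin.
have gz : g z <> 0.
  rewrite /g !subrr expr0n/= !sub0r => /eqP; rewrite mulrNN mulf_eq0 orbb sqrf_eq0.
  by rewrite gt_eqF.
(* A minimiser [y] of [F] lies on the boundary of the box, where [F] is nonnegative; as [F z = 0],
   the interior point [z] is then a minimiser too. *)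
apply: gz; apply: (noint _ BZ) => x xB; rewrite Fz.
apply: le_trans (ymin _ xB).
have gy := noint _ yB ymin; have [_ _ wy] := hw _ (BO _ yB).
have [py|py] := leP 0 (probe z y); last by rewrite /F mul1r; nra.
have wm := mP _ (conj yB (conj gy py)).
rewrite /F mul1r.
have : probe z y <= 1; last nra.
by move/boxP: yB => [b1 b2 b3 b4]; rewrite /probe; nra.
Qed.

End maximum_principle.

(** * Distances, discs and isometries of the half-plane *)

Section hyperbolic_plane.
Context {R : realType}.
Implicit Types (z w p c : R * R) (u : R * R -> R).

(** The hyperbolic cosine of [hdist]: comparing distances becomes comparing polynomials. *)
Definition hcosh z w : R :=
  1 + ((z.1 - w.1) ^+ 2 + (z.2 - w.2) ^+ 2) / (2 * z.2 * w.2).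

Definition coshr (r : R) : R := (expR r + expR (- r)) / 2.

Lemma hcosh_sym z w : hcosh z w = hcosh w z.
Proof. by rewrite /hcosh (mulrAC 2); congr (1 + (_ + _) / _); ring. Qed.

Lemma hcosh_lt z w (k : R) : H2 z -> H2 w ->
  (hcosh z w < k) =
  ((z.1 - w.1) ^+ 2 + (z.2 - w.2) ^+ 2 < (k - 1) * (2 * z.2 * w.2)).
Proof.
rewrite /H2/= /hcosh => z0 w0; rewrite -ltrBrDl ltr_pdivrMr//.
by rewrite !mulr_gt0.
Qed.

Lemma hcosh_le z w (k : R) : H2 z -> H2 w ->
  (hcosh z w <= k) =
  ((z.1 - w.1) ^+ 2 + (z.2 - w.2) ^+ 2 <= (k - 1) * (2 * z.2 * w.2)).
Proof.
rewrite /H2/= /hcosh => z0 w0; rewrite -lerBrDl ler_pdivrMr//.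
by rewrite !mulr_gt0.
Qed.

Lemma hcosh_ge1 z w : H2 z -> H2 w -> 1 <= hcosh z w.
Proof.
rewrite /H2/= /hcosh => z0 w0; rewrite lerDl divr_ge0 ?addr_ge0 ?sqr_ge0//.
by rewrite !mulr_ge0// ltW.
Qed.

Lemma hcosh_refl z : hcosh z z = 1.
Proof. by rewrite /hcosh !subrr expr0n/= addr0 mul0r addr0. Qed.

Lemma hcosh_continuous (T : topologicalType) (f g : T -> R * R) (x : T) :
  {for x, continuous f} -> {for x, continuous g} -> H2 (f x) -> H2 (g x) ->
  {for x, continuous (fun y => hcosh (f y) (g y))}.
Proof.
move=> cf cg fx gx; rewrite /hcosh; cont.
by rewrite !mulf_neq0// gt_eqF.
Qed.

Lemma acosh_spec (t : R) : 1 <= t ->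
  [/\ 0 <= acoshR t & coshr (acoshR t) = t].
Proof.
move=> t1; have s0 : 0 <= Num.sqrt (t ^+ 2 - 1) by exact: sqrtr_ge0.
have ss : Num.sqrt (t ^+ 2 - 1) ^+ 2 = t ^+ 2 - 1 by rewrite sqr_sqrtr//; nra.
rewrite /acoshR /coshr; set s := Num.sqrt _ in s0 ss *.
have E1 : 1 <= t + s by lra.
split; first by rewrite ln_ge0.
rewrite expRN lnK ?posrE; last by lra.
have -> : (t + s)^-1 = t - s.
  apply: (@mulfI _ (t + s)); first by rewrite gt_eqF//; lra.
  by rewrite mulfV ?gt_eqF//; [nra|lra].
by lra.
Qed.

Lemma coshr_lt (a b : R) : 0 <= a -> 0 <= b -> (coshr a < coshr b) = (a < b).
Proof.
move=> a0 b0; rewrite /coshr !expRN -(ltr_expR a b).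
have : 1 <= expR a by rewrite -expR0 ler_expR.
have : 1 <= expR b by rewrite -expR0 ler_expR.
move: (expR a) (expR b) => x y y1 x1.
have [x0 y0] : 0 < x /\ 0 < y by split; lra.
rewrite ltr_pM2r ?invr_gt0// -subr_gt0.
have -> : y + y^-1 - (x + x^-1) = (y - x) * ((x * y - 1) / (x * y)).
  by field; rewrite !gt_eqF.
have [->|xy] := eqVneq x y; first by rewrite subrr mul0r !ltxx.
rewrite pmulr_lgt0 ?subr_gt0// divr_gt0 ?mulr_gt0// subr_gt0.
have [xy1|] := ltrP 1 (x * y); first by [].
move=> xy1; exfalso; move/eqP: xy; apply.
have x1' : x = 1 by nra.
by subst x; nra.
Qed.

Lemma acosh_lt (t r : R) : 1 <= t -> 0 <= r -> (acoshR t < r) = (t < coshr r).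
Proof. by move=> /acosh_spec[a0 {2}<-] r0; rewrite coshr_lt. Qed.

Lemma acosh_le (s t : R) : 1 <= s -> s <= t -> acoshR s <= acoshR t.
Proof.
move=> s1 st; have /acosh_spec[t0 Et] : 1 <= t by lra.
by rewrite leNgt -Et in st; rewrite leNgt; apply: contra st => h;
   rewrite -(acosh_spec s1).2 coshr_lt//; have [] := acosh_spec s1.
Qed.

Lemma coshr_gt1 (r : R) : 0 < r -> 1 < coshr r.
Proof.
move=> r0; have := coshr_lt (lexx 0) (ltW r0); rewrite r0 /coshr oppr0 expR0.
by have -> : (1 + 1) / 2 = 1 :> R by lra.
Qed.

Lemma coshr_double (r : R) : coshr (2 * r) = 2 * coshr r ^+ 2 - 1.
Proof.
rewrite /coshr (_ : 2 * r = r + r); last by ring.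
rewrite opprD !expRD expRN; have := expR_gt0 r; move: (expR r) => e e0.
by field; rewrite gt_eqF.
Qed.

Definition hdisc c (k : R) : set (R * R) := [set z | H2 z /\ hcosh c z < k].
Definition hdiscbar c (k : R) : set (R * R) := [set z | H2 z /\ hcosh c z <= k].

Lemma hballE p (r : R) : H2 p -> 0 <= r -> hball p r = hdisc p (coshr r).
Proof.
move=> p0 r0; apply/seteqP; split => z [z0 hz]; split => //.
- by rewrite -acosh_lt ?hcosh_ge1//; exact: hz.
- by move: hz; rewrite -acosh_lt ?hcosh_ge1// => hz; exact: hz.
Qed.

Lemma open_H2 : open (@H2 R).
Proof.
rewrite openE => z z0; rewrite /interior.
by apply: (@cont_lt _ _ (fun=> 0) snd) => //; cont.
Qed.

Lemma hdisc_open c k : H2 c -> open (hdisc c k).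
Proof.
move=> c0; rewrite openE => z [z0 hz]; rewrite /interior.
have n1 := open_nbhs_nbhs (conj open_H2 z0).
have n2 : \forall y \near z, hcosh c y < k.
  apply: (@cont_lt _ _ (fun y => hcosh c y) (fun=> k)) => //; last exact: cont_cst.
  by apply: hcosh_continuous => //; cont.
by near=> y; split; near: y.
Unshelve. all: by end_near. Qed.

Definition hisometry (s : R * R -> R * R) := [/\
  forall z, H2 z -> H2 (s z),
  forall z w, H2 z -> H2 w -> hcosh (s z) (s w) = hcosh z w,
  forall z, H2 z -> {for z, continuous s} &
  forall u z, H2 z -> D2 u (s z) ->
    D2 (u \o s) z /\ hlap (u \o s) z = hlap u (s z)].

(** A conformal map preserves the metric divided by the squared height exactly when its factor is
    the ratio of the heights. *)
Lemma hisometry_lap (s1 s2 : R * R -> R) u z :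
  D2 s1 z -> D2 s2 z -> D2 u (s1 z, s2 z) -> H2 z ->
  pdx s1 z * pdx s2 z + pdy s1 z * pdy s2 z = 0 ->
  pdx s1 z ^+ 2 + pdy s1 z ^+ 2 = (s2 z / z.2) ^+ 2 ->
  pdx s2 z ^+ 2 + pdy s2 z ^+ 2 = (s2 z / z.2) ^+ 2 ->
  lap s1 z = 0 -> lap s2 z = 0 ->
  D2 (u \o (fun y => (s1 y, s2 y))) z /\
  hlap (u \o (fun y => (s1 y, s2 y))) z = hlap u (s1 z, s2 z).
Proof.
move=> h1 h2 hu z0 E1 E2 E3 E4 E5; split; first exact: D2_comp.
rewrite !hlapE (lap_conformal hu h1 h2 E1 E2 E3 E4 E5) mulrA; congr (_ * _).
by rewrite -exprMn mulrC divfK// gt_eqF.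
Qed.

Lemma D2_affine (a b c : R) z (f := fun y : R * R => a + b * y.1 + c * y.2) :
  [/\ D2 f z, pdx f z = b, pdy f z = c & lap f z = 0].
Proof.
have df x : differentiable f x by rewrite /f; dif.
have Df x d : is_derive x d f (b * d.1 + c * d.2).
  apply: is_derive_eq (is_derive_add (is_derive_add (is_derive_const a x d)
   (is_derive_mul (is_derive_const b x d) (is_derive_fst x d)))
   (is_derive_mul (is_derive_const c x d) (is_derive_snd x d))) _; ring.
have Ex : pdx f = fun=> b.
  by apply/funext => x; rewrite /pdx (@derive_val _ _ _ _ _ _ _ (Df x _))/=; ring.
have Ey : pdy f = fun=> c.
  by apply/funext => x; rewrite /pdy (@derive_val _ _ _ _ _ _ _ (Df x _))/=; ring.
split; rewrite ?Ex ?Ey//; last by rewrite /lap Ex Ey /pdx /pdy !derive_cst addr0.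
by split; rewrite ?Ex ?Ey; [near=> x; exact: df | dif | dif].
Unshelve. all: by end_near. Qed.

(* With [e = 1] a translation composed with a homothety, with [e = - 1] followed
   by a reflection in a vertical geodesic. *)
Definition haff (a m e : R) z : R * R := (a + e * m * z.1 + 0 * z.2, 0 + 0 * z.1 + m * z.2).

Lemma haff_isometry (a m e : R) : 0 < m -> e ^+ 2 = 1 -> hisometry (haff a m e).
Proof.
move=> m0 e1; split.
- by move=> z z0; rewrite /H2 /haff/= mul0r !add0r mulr_gt0.
- move=> z w z0 w0; rewrite /hcosh /haff/=; congr (1 + _).
  have -> : (a + e * m * z.1 + 0 * z.2 - (a + e * m * w.1 + 0 * w.2)) ^+ 2 =
     e ^+ 2 * m ^+ 2 * (z.1 - w.1) ^+ 2 by ring.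
  rewrite e1; field.
  by rewrite !gt_eqF.
- by move=> z z0; rewrite /haff; cont.
- move=> u z z0 hu.
  have [h1 x1 y1 l1] := D2_affine a (e * m) 0 z.
  have [h2 x2 y2 l2] := D2_affine 0 0 m z.
  have E : m = (0 + 0 * z.1 + m * z.2) / z.2.
    by rewrite mul0r !add0r mulfK// gt_eqF.
  by apply: (hisometry_lap h1 h2 hu z0); rewrite ?x1 ?x2 ?y1 ?y2 ?l1 ?l2 -?E;
    rewrite ?exprMn ?e1; ring.
Qed.

(** Inversion in the circle of centre [(o, 0)] and radius sqrt [k], that is, the reflection in a
    half-circle geodesic. *)
Definition hinv (o k : R) z : R * R :=
  (o + k * ((z.1 - o) * ((z.1 - o) ^+ 2 + z.2 ^+ 2)^-1),
   k * (z.2 * ((z.1 - o) ^+ 2 + z.2 ^+ 2)^-1)).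

Section inversion.
Variables (o k : R).
Hypothesis k0 : 0 < k.
Let q z := (z.1 - o) ^+ 2 + z.2 ^+ 2.
(** Up to sign and the factor [k], the entries of the Jacobian matrix of the inversion are [A] and
    [2 * B]. *)
Let A z := (z.2 ^+ 2 - (z.1 - o) ^+ 2) * ((q z) ^+ 2)^-1.
Let B z := ((z.1 - o) * z.2) * ((q z) ^+ 2)^-1.

Let q_gt0 z : H2 z -> 0 < q z.
Proof. by rewrite /H2/= => z0; rewrite /q ltr_wpDl ?sqr_ge0// exprn_gt0. Qed.

Lemma hinv_H2 z : H2 z -> H2 (hinv o k z).
Proof. by move=> z0; rewrite /H2 /hinv/= !mulr_gt0// invr_gt0; exact: q_gt0. Qed.

Lemma hinvK z : H2 z -> hinv o k (hinv o k z) = z.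
Proof.
move=> z0; have q0 := q_gt0 z0.
have qE : (o + k * ((z.1 - o) * (q z)^-1) - o) ^+ 2 + (k * (z.2 * (q z)^-1)) ^+ 2
   = k ^+ 2 * (q z)^-1.
  have -> : (o + k * ((z.1 - o) * (q z)^-1) - o) ^+ 2 + (k * (z.2 * (q z)^-1)) ^+ 2
     = k ^+ 2 * (q z)^-1 ^+ 2 * q z by rewrite {4}/q; ring.
  by field; rewrite gt_eqF.
case: z z0 q0 qE => x y z0 q0 qE; rewrite /hinv/=.
rewrite -[(x - o) ^+ 2 + y ^+ 2]/(q (x, y)) qE; move: (q (x, y)) q0 => Q Q0.
by congr pair; field; rewrite !gt_eqF.
Qed.

Lemma hinv_hcosh z w : H2 z -> H2 w -> hcosh (hinv o k z) (hinv o k w) = hcosh z w.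
Proof.
move=> z0 w0; have qz := q_gt0 z0; have qw := q_gt0 w0.
rewrite /hcosh /hinv/=; congr (1 + _); rewrite -/(q z) -/(q w).
have -> : (o + k * ((z.1 - o) * (q z)^-1) - (o + k * ((w.1 - o) * (q w)^-1))) ^+ 2 +
  (k * (z.2 * (q z)^-1) - k * (w.2 * (q w)^-1)) ^+ 2 =
  k ^+ 2 * (q z)^-1 * (q w)^-1 * ((z.1 - w.1) ^+ 2 + (z.2 - w.2) ^+ 2).
  move: qz qw; rewrite /q => qz qw; field.
  by rewrite !gt_eqF.
by field; rewrite !gt_eqF.
Qed.

Let q_derive z d : is_derive z d q (2 * (z.1 - o) * d.1 + 2 * z.2 * d.2).
Proof.
apply: is_derive_eq (is_derive_add (is_derive_sqr (is_derive_add
  (is_derive_fst z d) (is_derive_const (- o) z d)))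
  (is_derive_sqr (is_derive_snd z d))) _; ring.
Qed.

Let q_dif z : differentiable q z.
Proof. by rewrite /q; dif. Qed.

Let s1 z := o + k * ((z.1 - o) * (q z)^-1).
Let s2 z := k * (z.2 * (q z)^-1).

Let s1_derive z d : H2 z -> is_derive z d s1 (k * A z * d.1 - 2 * k * B z * d.2).
Proof.
move=> z0; have q0 := q_gt0 z0; have qn : q z != 0 by rewrite gt_eqF.
apply: is_derive_eq (is_derive_add (is_derive_const o z d)
  (is_derive_mul (is_derive_const k z d) (is_derive_mul
  (is_derive_add (is_derive_fst z d) (is_derive_const (- o) z d))
  (is_derive_inv qn (q_derive z d))))) _.
by move: qn; rewrite /A /B /q => qn; field.
Qed.

Let s2_derive z d : H2 z -> is_derive z d s2 (- 2 * k * B z * d.1 - k * A z * d.2).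
Proof.
move=> z0; have q0 := q_gt0 z0; have qn : q z != 0 by rewrite gt_eqF.
apply: is_derive_eq (is_derive_mul (is_derive_const k z d) (is_derive_mul
  (is_derive_snd z d) (is_derive_inv qn (q_derive z d)))) _.
by move: qn; rewrite /A /B /q => qn; field.
Qed.

Let A_derive z d : H2 z -> is_derive z d A
  ((2 * z.2 * d.2 - 2 * (z.1 - o) * d.1) / q z ^+ 2 -
   2 * (z.2 ^+ 2 - (z.1 - o) ^+ 2) * (2 * (z.1 - o) * d.1 + 2 * z.2 * d.2) / q z ^+ 3).
Proof.
move=> z0; have q0 := q_gt0 z0; have qn : q z != 0 by rewrite gt_eqF.
have qn2 : q z ^+ 2 != 0 by rewrite expf_neq0.
apply: is_derive_eq (is_derive_mul (is_derive_add (is_derive_sqr (is_derive_snd z d))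
  (is_derive_opp (is_derive_sqr (is_derive_add (is_derive_fst z d)
  (is_derive_const (- o) z d))))) (is_derive_inv (f := fun y => q y ^+ 2) qn2 (is_derive_sqr (q_derive z d)))) _.
by move: (q z) qn => Q Qn /=; field.
Qed.

Let B_derive z d : H2 z -> is_derive z d B
  ((d.1 * z.2 + (z.1 - o) * d.2) / q z ^+ 2 -
   2 * ((z.1 - o) * z.2) * (2 * (z.1 - o) * d.1 + 2 * z.2 * d.2) / q z ^+ 3).
Proof.
move=> z0; have q0 := q_gt0 z0; have qn : q z != 0 by rewrite gt_eqF.
have qn2 : q z ^+ 2 != 0 by rewrite expf_neq0.
apply: is_derive_eq (is_derive_mul (is_derive_mul (is_derive_add (is_derive_fst z d)
  (is_derive_const (- o) z d)) (is_derive_snd z d))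
  (is_derive_inv (f := fun y => q y ^+ 2) qn2 (is_derive_sqr (q_derive z d)))) _.
by move: (q z) qn => Q Qn /=; field.
Qed.

Let near_H2 z : H2 z -> \forall y \near z, H2 y.
Proof. by move=> z0; exact: open_nbhs_nbhs (conj open_H2 z0). Qed.

Let AB_dif z : H2 z -> differentiable A z /\ differentiable B z.
Proof.
move=> z0; have qn : q z != 0 by rewrite gt_eqF// q_gt0.
have qd := q_dif z.
have qn2 : q z ^+ 2 != 0 by rewrite expf_neq0.
by split; rewrite /A /B; dif.
Qed.

Let s1_D2 z : H2 z -> [/\ D2 s1 z, pdx s1 z = k * A z, pdy s1 z = - 2 * k * B z &
  lap s1 z = 0].
Proof.
move=> z0; have [dA dB] := AB_dif z0.
have Ex y : H2 y -> k * A y = pdx s1 y.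
  by move=> y0; rewrite /pdx (@derive_val _ _ _ _ _ _ _ (s1_derive _ y0))/=; ring.
have Ey y : H2 y -> - 2 * k * B y = pdy s1 y.
  by move=> y0; rewrite /pdy (@derive_val _ _ _ _ _ _ _ (s1_derive _ y0))/=; ring.
have nx : \forall y \near z, k * A y = pdx s1 y.
  by apply: filterS (near_H2 z0) => y /Ex.
have ny : \forall y \near z, - 2 * k * B y = pdy s1 y.
  by apply: filterS (near_H2 z0) => y /Ey.
split; rewrite ?Ex ?Ey//.
  split.
  - apply: filterS (near_H2 z0) => y y0; have qn : q y != 0 by rewrite gt_eqF// q_gt0.
    by have qd := q_dif y; rewrite /s1; dif.
  - by apply: near_differentiable nx _; dif.
  - by apply: near_differentiable ny _; dif.
rewrite /lap -(near_eq_pdx nx) -(near_eq_pdy ny) /pdx /pdy.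
rewrite (@derive_val _ _ _ _ _ _ _ (is_derive_mul (is_derive_const k z (1, 0)) (A_derive (1, 0) z0))).
rewrite (@derive_val _ _ _ _ _ _ _ (is_derive_mul (is_derive_const (- 2 * k) z (0, 1)) (B_derive (0, 1) z0))) /=.
have qn : q z != 0 by rewrite gt_eqF// q_gt0.
by move: qn; rewrite /q => qn; field.
Qed.

Let s2_D2 z : H2 z -> [/\ D2 s2 z, pdx s2 z = - 2 * k * B z, pdy s2 z = - k * A z &
  lap s2 z = 0].
Proof.
move=> z0; have [dA dB] := AB_dif z0.
have Ex y : H2 y -> - 2 * k * B y = pdx s2 y.
  by move=> y0; rewrite /pdx (@derive_val _ _ _ _ _ _ _ (s2_derive _ y0))/=; ring.
have Ey y : H2 y -> - k * A y = pdy s2 y.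
  by move=> y0; rewrite /pdy (@derive_val _ _ _ _ _ _ _ (s2_derive _ y0))/=; ring.
have nx : \forall y \near z, - 2 * k * B y = pdx s2 y.
  by apply: filterS (near_H2 z0) => y /Ex.
have ny : \forall y \near z, - k * A y = pdy s2 y.
  by apply: filterS (near_H2 z0) => y /Ey.
split; rewrite ?Ex ?Ey//.
  split.
  - apply: filterS (near_H2 z0) => y y0; have qn : q y != 0 by rewrite gt_eqF// q_gt0.
    by have qd := q_dif y; rewrite /s2; dif.
  - by apply: near_differentiable nx _; dif.
  - by apply: near_differentiable ny _; dif.
rewrite /lap -(near_eq_pdx nx) -(near_eq_pdy ny) /pdx /pdy.
rewrite (@derive_val _ _ _ _ _ _ _ (is_derive_mul (is_derive_const (- 2 * k) z (1, 0)) (B_derive (1, 0) z0))).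
rewrite (@derive_val _ _ _ _ _ _ _ (is_derive_mul (is_derive_const (- k) z (0, 1)) (A_derive (0, 1) z0))) /=.
have qn : q z != 0 by rewrite gt_eqF// q_gt0.
by move: qn; rewrite /q => qn; field.
Qed.

Lemma hinv_isometry : hisometry (hinv o k).
Proof.
split; [exact: hinv_H2 | exact: hinv_hcosh | |].
- move=> z z0; have qn : q z != 0 by rewrite gt_eqF// q_gt0.
  by rewrite /hinv; cont.
- move=> u z z0 hu; have [h1 x1 y1 l1] := s1_D2 z0; have [h2 x2 y2 l2] := s2_D2 z0.
  have qn : q z != 0 by rewrite gt_eqF// q_gt0.
  have zn : z.2 != 0 by rewrite gt_eqF.
  apply: (hisometry_lap h1 h2 hu z0) => //; rewrite ?x1 ?x2 ?y1 ?y2; first ring.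
  + by move: qn; rewrite /s2 /A /B /q => qn; field; rewrite zn.
  + by move: qn; rewrite /s2 /A /B /q => qn; field; rewrite zn.
Qed.

End inversion.

End hyperbolic_plane.

(** * Comparison with a positive supersolution; compactness of closed discs *)

Section ball_eigenfunctions.
Context {R : realType}.
Implicit Types (z w p c : R * R) (u v : R * R -> R) (k lam : R).

Lemma compact_zero (T : topologicalType) (K : set T) (F : T -> R) : compact K ->
  {within K, continuous F} -> compact [set z | K z /\ F z = 0].
Proof.
move=> cK cF.
have /closed_subspaceP[V cV VE] : closed ([set z | F z = 0] : set (subspace K)).
  exact: closed_zero.
suff -> : [set z | K z /\ F z = 0] = K `&` V by exact: compact_closedI.
by rewrite setIC VE; apply/seteqP; split => z [].
Qed.

(** The hyperbolic Laplacian is the flat one times a positive factor, so the flat maximum principle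
    serves for both. *)
Lemma superharmonic_of_hlap u lam z : 0 <= lam -> H2 z -> 0 <= u z ->
  hlap u z + lam * u z <= 0 -> lap u z <= 0.
Proof.
rewrite hlapE; move: (lap u z) => L l0 z0 u0 h.
have : z.2 ^+ 2 * L <= 0 by have := mulr_ge0 l0 u0; lra.
by rewrite pmulr_rle0// exprn_gt0.
Qed.

Lemma hlap_lin u v (a b : R) z : D2 u z -> D2 v z ->
  hlap (fun y => a * u y + b * v y) z = a * hlap u z + b * hlap v z.
Proof.
move=> hu hv; rewrite !hlapE (D2_lin a b hu hv).2.
by move: (lap u z) (lap v z) => A B; ring.
Qed.

(* Minimise [w / g]: if the minimum is [- m < 0], then [w + m g] is nonnegative,
   superharmonic and vanishes inside. *)
Lemma eigen_comparison (O K : set (R * R)) (w g : R * R -> R) lam : open O -> O `<=` @H2 R ->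
  compact K -> O `<=` K -> 0 <= lam ->
  {within K, continuous w} -> {within K, continuous g} ->
  (forall z, K z -> 0 < g z) -> (forall z, K z -> ~ O z -> 0 <= w z) ->
  (forall z, O z -> D2 w z /\ hlap w z + lam * w z <= 0) ->
  (forall z, O z -> D2 g z /\ hlap g z + lam * g z <= 0) ->
  forall z, O z -> 0 <= w z.
Proof.
move=> oO OH cK OK l0 cw cg gpos wbd hw hg z0 Oz0.
rewrite leNgt; apply/negP => wz0.
have [||z zK zmin] := @compact_EVT_min _ R (fun z => w z * (g z)^-1) K _ cK.
- by exists z0; exact: OK.
- rewrite continuous_subspace_in => z; rewrite inE => zK.
  apply: (@cont_mul R (subspace K) w (fun z => (g z)^-1) z); first exact: cw.
  by apply: (@cont_inv R (subspace K) g z); [rewrite gt_eqF// gpos|exact: cg].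
have {}zK : K z by rewrite inE in zK.
pose m := - (w z / g z).
have zmin' y : K y -> 0 <= w y + m * g y.
  move=> yK; have gy := gpos _ yK; have : w z / g z <= w y / g y by apply: zmin; rewrite inE.
  by rewrite ler_pdivlMr// /m; lra.
have m0 : 0 < m.
  have g0 := gpos _ (OK _ Oz0); have : w z / g z <= w z0 / g z0 by apply: zmin; rewrite inE; exact: OK.
  have : w z0 / g z0 < 0 by rewrite ltr_pdivrMr// mul0r.
  by rewrite /m; lra.
have Fz : w z + m * g z = 0.
  by rewrite /m mulNr divfK ?subrr// gt_eqF// gpos.
have KO y : K y -> w y + m * g y = 0 -> O y.
  move=> yK Fy; apply: contrapT => /(wbd _ yK) wy.
  by have := mulr_gt0 m0 (gpos _ yK); lra.
pose F y := 1 * w y + m * g y.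
have FE y : F y = w y + m * g y by rewrite /F mul1r.
(* On [K] outside [O] both terms of [F] have a sign and the second is positive, so that no zero lies
   there: the zeros in the open set [O] are those in the compact set [K]. *)
have cZ : compact [set y | O y /\ F y = 0].
  rewrite (_ : [set y | O y /\ F y = 0] = [set y | K y /\ F y = 0]).
    apply: compact_zero => // y; apply: (@cont_add R (subspace K) (fun y => 1 * w y) (fun y => m * g y) y).
      by apply: (@cont_mul R (subspace K) (fun=> 1) w y); [exact: cont_cst|exact: cw].
    by apply: (@cont_mul R (subspace K) (fun=> m) g y); [exact: cont_cst|exact: cg].
  apply/seteqP; split => y [yO Fy]; split => //; first exact: OK.
  by apply: KO => //; rewrite -FE.
suff : 0 < F z by rewrite FE Fz ltxx.
apply: superharmonic_pos cZ _ _; [exact: oO| |by apply: KO].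
move=> y Oy; have [Dw lw] := hw _ Oy; have [Dg lg] := hg _ Oy.
have [DF _] := D2_lin 1 m Dw Dg; split => //; last by rewrite FE zmin'//; exact: OK.
apply: (@superharmonic_of_hlap _ lam) => //; first exact: OH.
  by rewrite FE zmin'//; exact: OK.
rewrite (hlap_lin _ _ Dw Dg) FE.
move: (hlap w y) (hlap g y) (w y) (g y) lw lg m0 => A B a b h1 h2 m0.
have : m * (B + lam * b) <= 0 by rewrite pmulr_rle0.
by lra.
Qed.

(** The polynomial inequality already forces [z.2] to be positive, so that a closed disc is closed
    in the whole Euclidean plane and stays away from the boundary line. *)
Lemma hdiscbarE c k : H2 c -> 1 <= k -> hdiscbar c k =
  [set z | 0 <= (k - 1) * (2 * c.2 * z.2) - ((c.1 - z.1) ^+ 2 + (c.2 - z.2) ^+ 2)].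
Proof.
move=> c0 k1; apply/seteqP; split => z.
  by move=> [z0]; rewrite hcosh_le// => h; rewrite /= subr_ge0.
rewrite /= subr_ge0 => h; have c0' : 0 < c.2 := c0.
have z0 : H2 z.
  rewrite /H2/= ltNge; apply/negP => z0.
  have : (k - 1) * (2 * c.2 * z.2) <= 0.
    by rewrite mulr_ge0_le0 ?subr_ge0// mulr_ge0_le0// mulr_ge0// ltW.
  have := sqr_ge0 (c.1 - z.1); nra.
by split => //; rewrite hcosh_le.
Qed.

Lemma hdiscbar_closed c k : H2 c -> 1 <= k -> closed (hdiscbar c k).
Proof.
move=> c0 k1; rewrite hdiscbarE//; apply/closed_nonneg/continuous_pointwise => z; cont.
Qed.

(** Dropping the horizontal term leaves c_2^2 + z_2^2 <= 2 k c_2 z_2: within a disc, heights agree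
    up to the factor 2 k. *)
Lemma hdiscbar_box c k z : H2 c -> 1 <= k -> hdiscbar c k z ->
  box c (2 * k * c.2) z /\ c.2 <= 2 * k * z.2.
Proof.
move=> c0 k1 [z0]; rewrite hcosh_le// => h; have c0' : 0 < c.2 := c0; have z0' : 0 < z.2 := z0.
have s1 := sqr_ge0 (c.1 - z.1); have s2 := sqr_ge0 (c.2 - z.2).
have zk : z.2 <= 2 * k * c.2.
  rewrite -(ler_pM2r z0'); nra.
have ck : c.2 <= 2 * k * z.2.
  rewrite -(ler_pM2r c0'); nra.
have kc : 0 < k * c.2 by nra.
have d1 : (c.1 - z.1) ^+ 2 <= (2 * k * c.2) ^+ 2.
  have : (k - 1) * (2 * c.2 * z.2) <= (k - 1) * (2 * c.2 * (2 * k * c.2)).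
    by rewrite ler_wpM2l ?subr_ge0// ler_wpM2l// mulr_ge0// ltW.
  nra.
have : `|c.1 - z.1| <= 2 * k * c.2.
  by rewrite -(@ler_pXn2r _ 2%N)// ?nnegrE ?normr_ge0//; [rewrite real_normK// num_real|lra].
rewrite ler_norml => /andP[? ?].
split => //; apply/boxP; split; nra.
Qed.

Lemma hdiscbar_compact c k : H2 c -> 1 <= k -> compact (hdiscbar c k).
Proof.
move=> c0 k1; apply: subclosed_compact (hdiscbar_closed c0 k1) _ _.
  exact: (@box_compact _ c (2 * k * c.2)).
by move=> z /(hdiscbar_box c0 k1)[].
Qed.

(** A Euclidean segment rather than a geodesic: the distance to [c] decreases along it as well, and
    its points are affine in [t]. *)
Definition toward z c (t : R) : R * R := (z.1 + t * (c.1 - z.1), z.2 + t * (c.2 - z.2)).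

Lemma toward_H2 z c (t : R) : H2 z -> H2 c -> 0 <= t <= 1 -> H2 (toward z c t).
Proof.
rewrite /H2 /toward/= => z0 c0 /andP[t0 t1].
have -> : z.2 + t * (c.2 - z.2) = (1 - t) * z.2 + t * c.2 by ring.
have [->|t1'] := eqVneq t 1; first by rewrite subrr mul0r add0r mul1r.
rewrite ltr_pwDl ?mulr_ge0// ?ltW// mulr_gt0// subr_gt0 lt_neqAle t1'//.
Qed.

Lemma hcosh_toward z c (t : R) : H2 z -> H2 c -> z <> c -> 0 < t <= 1 ->
  hcosh c (toward z c t) < hcosh c z.
Proof.
move=> z0 c0 zc /andP[t0 t1].
have zt := toward_H2 z0 c0 (_ : 0 <= t <= 1).
have {}zt : H2 (toward z c t) by apply: zt; rewrite ltW.
have z0' : 0 < z.2 := z0; have c0' : 0 < c.2 := c0.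
rewrite hcosh_lt// {1}/hcosh addrAC subrr add0r mulrAC ltr_pdivlMr; last first.
  by rewrite mulr_gt0// mulr_gt0.
have D0 : 0 < (c.1 - z.1) ^+ 2 + (c.2 - z.2) ^+ 2.
  rewrite lt_neqAle addr_ge0 ?sqr_ge0// andbT eq_sym paddr_eq0 ?sqr_ge0//.
  apply/negP; rewrite !sqrf_eq0 !subr_eq0 => /andP[/eqP e1 /eqP e2].
  by apply: zc; rewrite (surjective_pairing z) (surjective_pairing c) e1 e2.
rewrite /toward/=.
have -> : (c.1 - (z.1 + t * (c.1 - z.1))) ^+ 2 + (c.2 - (z.2 + t * (c.2 - z.2))) ^+ 2
  = (1 - t) ^+ 2 * ((c.1 - z.1) ^+ 2 + (c.2 - z.2) ^+ 2) by ring.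
rewrite -subr_gt0.
move: ((c.1 - z.1) ^+ 2 + _) D0 => D D0.
have -> : D * (2 * c.2 * (z.2 + t * (c.2 - z.2))) - (1 - t) ^+ 2 * D * (2 * c.2 * z.2)
   = 2 * c.2 * D * t * (c.2 + (1 - t) * z.2) by ring.
by rewrite !mulr_gt0// ltr_pwDl// mulr_ge0 ?subr_ge0// ltW.
Qed.

Lemma near_toward z c (A : set (R * R)) : nbhs z A ->
  \forall t \near 0^'+, A (toward z c t).
Proof.
move=> nA; have h : {for (0 : R), continuous (fun t : R => toward z c t)}.
  by rewrite /toward; cont.
apply: (@cvg_within _ (nbhs (0 : R))); apply: h.
by rewrite /toward !mul0r !addr0 -surjective_pairing.
Qed.

End ball_eigenfunctions.

(** * Reflections, transport of the eigenfunction, and its maximum at the centre *)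

Section eigenfunction_centre.
Context {R : realType}.
Implicit Types (z w p c : R * R) (u v : R * R -> R) (k lam : R).

(** The numerator is the equation of the perpendicular bisector of [p] and [z]: a vertical line at
    equal heights, a circle otherwise. *)
Lemma hcosh_sub p z w : H2 p -> H2 z -> H2 w -> hcosh p w - hcosh z w =
  (z.2 * ((p.1 - w.1) ^+ 2 + (p.2 - w.2) ^+ 2) -
   p.2 * ((z.1 - w.1) ^+ 2 + (z.2 - w.2) ^+ 2)) / (2 * p.2 * z.2 * w.2).
Proof.
by rewrite /H2/= /hcosh => p0 z0 w0; field; rewrite !gt_eqF.
Qed.

Lemma hdisc_toward c k z : H2 c -> 1 < k -> hdiscbar c k z ->
  \forall t \near 0^'+, hdisc c k (toward z c t).
Proof.
move=> c0 k1 [z0 zk]; near=> t.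
have t0 : 0 < t by near: t; exact: nbhs_right_gt.
have t1 : t <= 1 by near: t; apply: nbhs_right_le.
have zt : H2 (toward z c t) by apply: toward_H2; rewrite // ltW.
split => //; have [->|/eqP zc] := eqVneq z c.
  have -> : toward c c t = c by rewrite /toward !subrr mulr0 !addr0 -surjective_pairing.
  by rewrite hcosh_refl.
by apply: lt_le_trans zk; apply: hcosh_toward; rewrite // t0.
Unshelve. all: by end_near. Qed.

Lemma hdisc_closure c k z : H2 c -> 1 < k -> hdiscbar c k z -> closure (hdisc c k) z.
Proof.
move=> c0 k1 zk B nB.
have [t [Bt Dt]] : exists t, B (toward z c t) /\ hdisc c k (toward z c t).
  have H : \forall t \near 0^'+, B (toward z c t) /\ hdisc c k (toward z c t).
    by apply: filterS2 (near_toward c nB) (hdisc_toward c0 k1 zk) => t.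
  by have [t ht] := @filter_ex _ _ (at_right_proper_filter (0 : R)) _ H; exists t.
by exists (toward z c t).
Qed.

Lemma hclosure_hdisc c k : H2 c -> 1 < k -> hclosure (hdisc c k) = hdiscbar c k.
Proof.
move=> c0 k1; apply/seteqP; split => z.
  move=> [zc _]; apply: (hdiscbar_closed c0 (ltW k1)) => B /zc[y [[y0 /ltW yk] By]].
  by exists y; split.
by move=> zk; split; [exact: hdisc_closure|case: zk].
Qed.

Lemma hswap p z : H2 p -> H2 z -> p <> z -> exists s, [/\ hisometry s,
  s p = z, s z = p & forall w, H2 w -> hcosh p w = hcosh z w -> s w = w].
Proof.
move=> p0 z0 pz; have [p0' z0'] : 0 < p.2 /\ 0 < z.2 by [].
have cross w : H2 w -> hcosh p w = hcosh z w ->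
  z.2 * ((p.1 - w.1) ^+ 2 + (p.2 - w.2) ^+ 2) -
  p.2 * ((z.1 - w.1) ^+ 2 + (z.2 - w.2) ^+ 2) = 0.
  move=> w0 /eqP; rewrite -subr_eq0 hcosh_sub// mulf_eq0 invr_eq0.
  by rewrite (@gt_eqF _ _ (2 * p.2 * z.2 * w.2)) ?mulr_gt0// orbF => /eqP.
have [e2|n2] := eqVneq p.2 z.2.
  exists (haff (p.1 + z.1) 1 (- 1)); split.
  - by apply: haff_isometry => //; rewrite sqrrN expr1n.
  - by rewrite /haff (surjective_pairing z) -e2; congr pair => /=; ring.
  - by rewrite /haff (surjective_pairing p) e2; congr pair => /=; ring.
  - move=> w w0 /(cross _ w0) /eqP.
    have -> : z.2 * ((p.1 - w.1) ^+ 2 + (p.2 - w.2) ^+ 2) -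
      p.2 * ((z.1 - w.1) ^+ 2 + (z.2 - w.2) ^+ 2) =
      p.2 * ((p.1 - z.1) * (p.1 + z.1 - 2 * w.1)) by rewrite -e2; ring.
    rewrite !mulf_eq0 (gt_eqF p0') /= => /orP[|/eqP h].
      rewrite subr_eq0 => /eqP e1; exfalso; apply: pz.
      by rewrite (surjective_pairing p) (surjective_pairing z) e1 e2.
    by rewrite /haff [RHS]surjective_pairing; congr pair; lra.
pose t := (z.1 - p.1) / (z.2 - p.2).
have zp : z.2 - p.2 != 0 by rewrite subr_eq0 eq_sym.
have z1 : z.1 = p.1 + t * (z.2 - p.2) by rewrite /t divfK// addrC subrK.
(* The Euclidean line through [p] and [z] meets the boundary line at abscissa [o], and [k] is the
   product of the distances from there to [p] and to [z]; hence the inversion exchanges them. *)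
pose o := p.1 - p.2 * t; pose k := p.2 * z.2 * (1 + t ^+ 2).
have t2 : 0 < 1 + t ^+ 2 by rewrite ltr_pwDl// sqr_ge0.
have k0 : 0 < k by rewrite /k !mulr_gt0.
exists (hinv o k); split.
- exact: hinv_isometry.
- rewrite /hinv (surjective_pairing z) z1 /o.
  have -> : (p.1 - (p.1 - p.2 * t)) ^+ 2 + p.2 ^+ 2 = p.2 ^+ 2 * (1 + t ^+ 2) by ring.
  by congr pair; rewrite /k /=; move: (1 + t ^+ 2) t2 => T T0; field; rewrite !gt_eqF.
- rewrite /hinv (surjective_pairing p) z1 /o /=.
  have -> : (p.1 + t * (z.2 - p.2) - (p.1 - p.2 * t)) ^+ 2 + z.2 ^+ 2 =
    z.2 ^+ 2 * (1 + t ^+ 2) by ring.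
  by congr pair; rewrite /k /=; move: (1 + t ^+ 2) t2 => T T0; field; rewrite !gt_eqF.
- move=> w w0 /(cross _ w0).
  have -> : z.2 * ((p.1 - w.1) ^+ 2 + (p.2 - w.2) ^+ 2) -
      p.2 * ((z.1 - w.1) ^+ 2 + (z.2 - w.2) ^+ 2) =
      (z.2 - p.2) * ((w.1 - o) ^+ 2 + w.2 ^+ 2 - k).
    by rewrite z1 /o /k; ring.
  move=> /eqP; rewrite mulf_eq0 (negbTE zp)/= subr_eq0 => /eqP E.
  rewrite /hinv E [RHS]surjective_pairing; congr pair; field; by rewrite gt_eqF.
Qed.

(** At equal heights the perpendicular bisector is a vertical line. An involution is supplied so
    that the same map also leads back. *)
Lemma hnormalize x y : H2 x -> H2 y -> exists g, [/\ hisometry (R:=R) g,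
  forall z, H2 z -> g (g z) = z & (g x).2 = (g y).2].
Proof.
move=> x0 y0; have [x0' y0'] : 0 < x.2 /\ 0 < y.2 by [].
have [e2|n2] := eqVneq x.2 y.2.
  exists (haff 0 1 1); split; first by apply: haff_isometry; rewrite // expr1n.
  - move=> z z0; rewrite /haff [RHS]surjective_pairing; congr pair => /=; ring.
  - by rewrite /haff/= e2 !mul0r.
pose t := (y.1 - x.1) / (y.2 - x.2).
have yx : y.2 - x.2 != 0 by rewrite subr_eq0 eq_sym.
have y1 : y.1 = x.1 + t * (y.2 - x.2) by rewrite /t divfK// addrC subrK.
(* The perpendicular bisector is the half-circle of centre [x.1 - x.2 * t] and radius [rho], and [e]
   is one of its ends. Inversion about [e] sends this end to infinity and makes the bisector
   vertical. *)
pose rho := Num.sqrt (x.2 * y.2 * (1 + t ^+ 2)).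
have t2 : 0 < 1 + t ^+ 2 by rewrite ltr_pwDl// sqr_ge0.
have r2 : rho ^+ 2 = x.2 * y.2 * (1 + t ^+ 2) by rewrite sqr_sqrtr// !mulr_ge0// ltW.
pose e := x.1 - x.2 * t + rho.
exists (hinv e 1); split; first exact: hinv_isometry.
- by move=> z; exact: hinvK.
- rewrite /hinv/= !mul1r y1 /e.
  have -> : (x.1 - (x.1 - x.2 * t + rho)) ^+ 2 + x.2 ^+ 2 =
    x.2 * ((x.2 + y.2) * (1 + t ^+ 2) - 2 * t * rho).
    have -> : (x.1 - (x.1 - x.2 * t + rho)) ^+ 2 + x.2 ^+ 2 =
      x.2 ^+ 2 * (1 + t ^+ 2) - 2 * x.2 * t * rho + rho ^+ 2 by ring.
    by rewrite r2; ring.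
  have -> : (x.1 + t * (y.2 - x.2) - (x.1 - x.2 * t + rho)) ^+ 2 + y.2 ^+ 2 =
    y.2 * ((x.2 + y.2) * (1 + t ^+ 2) - 2 * t * rho).
    have -> : (x.1 + t * (y.2 - x.2) - (x.1 - x.2 * t + rho)) ^+ 2 + y.2 ^+ 2 =
      y.2 ^+ 2 * (1 + t ^+ 2) - 2 * y.2 * t * rho + rho ^+ 2 by ring.
    by rewrite r2; ring.
  by rewrite !invfM !mulrA !mulfV ?gt_eqF.
Qed.

Definition ball_eigen lam p k v := [/\ {within hdiscbar p k, continuous v},
  forall z, hdisc p k z -> [/\ D2 v z, hlap v z + lam * v z = 0 & 0 < v z] &
  forall z, H2 z -> hcosh p z = k -> v z = 0].

Lemma within_comp (T X Y : topologicalType) (K : set T) (L : set X) (s : T -> X)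
    (v : X -> Y) (z : T) :
  (forall y, K y -> L (s y)) -> K z -> {for z, continuous s} ->
  {within L, continuous v} -> v (s y) @[y --> within K (nbhs z)] --> v (s z).
Proof.
move=> KL Kz cs /subspace_continuousP/(_ _ (KL _ Kz)) cv.
apply: cvg_comp cv => A nA.
apply: (@filterS _ (nbhs z) _ (fun y => L (s y) -> A (s y))); last exact: cs nA.
by move=> y h /KL.
Qed.

Lemma ball_eigen_isometry lam p c k v s : hisometry s -> H2 c -> s c = p ->
  ball_eigen lam p k v -> ball_eigen lam c k (v \o s).
Proof.
move=> [sH sC sc sl] c0 scp [cv hv bv].
have Cs z : H2 z -> hcosh p (s z) = hcosh c z by move=> z0; rewrite -scp sC.
split.
- apply/subspace_continuousP => z zk; apply: within_comp (cv) => //; last exact: sc zk.1.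
  by move=> y [y0 yk]; split; [exact: sH|rewrite Cs].
- move=> z [z0 zk]; have sz : hdisc p k (s z) by split; [exact: sH|rewrite Cs].
  have [D E P] := hv _ sz; have [D' E'] := sl v z z0 D.
  by split; [exact: D'|rewrite E'; exact: E|exact: P].
- by move=> z z0 zk /=; apply: bv; [exact: sH|rewrite Cs].
Qed.

Lemma ball_eigen_ge0 lam p k v z : ball_eigen lam p k v -> hdiscbar p k z -> 0 <= v z.
Proof.
move=> [_ hv bv] [z0]; rewrite le_eqVlt => /orP[/eqP zk|zk]; first by rewrite bv.
by have [|_ _ /ltW] := hv z.
Qed.

(** Among the isometries taking [c] to [p], the affine one: its coefficients are rational in [c], so
    that the copy of [v] varies continuously with the centre, and it maps Euclidean rays to
    Euclidean rays. *)
Definition recentre p c := haff (p.1 - p.2 / c.2 * c.1) (p.2 / c.2) 1.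

Lemma recentre_isometry p c : H2 p -> H2 c -> hisometry (recentre p c).
Proof. by move=> p0 c0; apply: haff_isometry; rewrite ?expr1n// divr_gt0. Qed.

Lemma recentre_centre p c : H2 c -> recentre p c c = p.
Proof.
move=> c0; rewrite /recentre /haff (surjective_pairing p); congr pair => /=; first ring.
by field; rewrite gt_eqF.
Qed.

Lemma recentre_eigen lam p c k v : H2 p -> H2 c ->
  ball_eigen lam p k v -> ball_eigen lam c k (v \o recentre p c).
Proof.
move=> p0 c0.
exact: (ball_eigen_isometry (recentre_isometry p0 c0) c0 (recentre_centre p c0)).
Qed.

(* Reflect in the perpendicular bisector of [p z]. On the half of the disc on the
   side of [z] the difference [v \o s - v] is nonnegative on the boundary, and the
   eigenfunction centred at the Euclidean midpoint is positive up to the boundary. *)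
Lemma ball_eigen_max lam p k v z : 0 <= lam -> H2 p -> 1 < k ->
  ball_eigen lam p k v -> hdiscbar p k z -> v z <= v p.
Proof.
have sub_eq (l A B a b : R) : A + l * a = 0 -> B + l * b = 0 ->
    1 * B + - 1 * A + l * (1 * b + - 1 * a) <= 0.
  by move=> hA hB; lra.
move=> l0 p0 k1 ev [z0 zk]; have [cv hv bv] := ev; have p0' : 0 < p.2 := p0.
have pk : hdisc p k p by split; rewrite ?hcosh_refl.
have vp0 : 0 < v p by have [] := hv _ pk.
move: zk; rewrite le_eqVlt => /orP[/eqP zk|zk]; first by rewrite bv// ltW.
have [->//|/eqP zp] := eqVneq z p; have z0' : 0 < z.2 := z0.
have [|s [his sp sz sfix]] := hswap p0 z0; first by move=> /esym.
have [sH sC sc sl] := his.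
have Cs w : H2 w -> hcosh p (s w) = hcosh z w by move=> w0; rewrite -{1}sz sC.
pose L w := z.2 * ((p.1 - w.1) ^+ 2 + (p.2 - w.2) ^+ 2) -
   p.2 * ((z.1 - w.1) ^+ 2 + (z.2 - w.2) ^+ 2).
have d0 w : H2 w -> 0 < 2 * p.2 * z.2 * w.2 by move=> w0; rewrite !mulr_gt0.
have LE w : H2 w -> (0 <= L w) = (hcosh z w <= hcosh p w).
  by move=> w0; rewrite -[in RHS]subr_ge0 hcosh_sub// pmulr_lge0 ?invr_gt0 ?d0.
have LT w : H2 w -> (0 < L w) = (hcosh z w < hcosh p w).
  by move=> w0; rewrite -[in RHS]subr_gt0 hcosh_sub// pmulr_lgt0 ?invr_gt0 ?d0.
have cL : continuous L by apply: continuous_pointwise => w; rewrite /L; cont.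
have D0 : 0 < (p.1 - z.1) ^+ 2 + (p.2 - z.2) ^+ 2.
  rewrite lt_neqAle addr_ge0 ?sqr_ge0// andbT eq_sym paddr_eq0 ?sqr_ge0//.
  apply/negP; rewrite !sqrf_eq0 !subr_eq0 => /andP[/eqP e1 /eqP e2].
  by apply: zp; rewrite (surjective_pairing z) (surjective_pairing p) e1 e2.
pose W := hdisc p k `&` [set w | 0 < L w].
pose K := hdiscbar p k `&` [set w | 0 <= L w].
have WK : W `<=` K by move=> w [[w0 wk] Lw]; split; [split => //|]; exact: ltW.
have Ks w : K w -> hdiscbar p k (s w).
  move=> [[w0 wk] /=]; rewrite LE// => Lw; split; first exact: sH.
  by rewrite Cs//; exact: le_trans wk.
pose c := ((p.1 + z.1) / 2, (p.2 + z.2) / 2) : R * R.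
have c0 : H2 c by rewrite /H2/= divr_gt0// addr_gt0.
(* A point of [K] is within the radius of both [p] and [z]; averaging the two polynomial
   inequalities gains a quarter of the squared Euclidean distance between [p] and [z], whence the
   strict inequality at the midpoint. *)
have Kc w : K w -> hdisc c k w.
  move=> [[w0 wk] /=]; rewrite LE// => Lw; split => //.
  have wz : hcosh z w <= k by exact: le_trans wk.
  move: wk wz; rewrite !hcosh_le// hcosh_lt// /c/= => wk wz.
  have -> : ((p.1 + z.1) / 2 - w.1) ^+ 2 + ((p.2 + z.2) / 2 - w.2) ^+ 2 =
    ((p.1 - w.1) ^+ 2 + (p.2 - w.2) ^+ 2 + ((z.1 - w.1) ^+ 2 + (z.2 - w.2) ^+ 2)) / 2
    - ((p.1 - z.1) ^+ 2 + (p.2 - z.2) ^+ 2) / 4 by field.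
  have -> : (k - 1) * (2 * ((p.2 + z.2) / 2) * w.2) =
    ((k - 1) * (2 * p.2 * w.2) + (k - 1) * (2 * z.2 * w.2)) / 2 by field.
  by lra.
have evc := recentre_eigen p0 c0 ev; have [cg hg bg] := evc.
have Wz : W z.
  split; first by split.
  by rewrite /= /L !subrr expr0n/= addr0 mulr0 subr0 mulr_gt0.
suff : 0 <= 1 * (v \o s) z + (- 1) * v z by rewrite /= sz; lra.
apply: (@eigen_comparison _ W K (fun w => 1 * (v \o s) w + (- 1) * v w)
  (v \o recentre p c) lam).
- apply: openI; first exact: hdisc_open.
  by move/continuousP: cL => h; exact: (h _ (@open_gt R 0)).
- by move=> w [[]].
- apply: compact_closedI; first by apply: hdiscbar_compact => //; exact: ltW.
  exact: closed_nonneg.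
- exact: WK.
- exact: l0.
- apply/subspace_continuousP => w wK.
  apply: cvgD; apply: cvgM; try exact: cvg_cst.
    by apply: within_comp (cv) => //; exact: sc wK.1.1.
  apply: (within_comp (s := id)) (cv) => //; first by move=> y [].
- apply: continuous_in_subspaceT => w; rewrite inE => /Kc /hg[Dw _ _].
  exact: D2_continuous.
- by move=> w /Kc /hg[].
- move=> w wK nW; have [[w0 wk] /= Lw] := wK.
  have [wk'|wk'] := eqVneq (hcosh p w) k.
    rewrite (bv w)// mulr0 addr0 mul1r; apply: ball_eigen_ge0 ev _; exact: Ks.
  have [Lw0|Lw0] := eqVneq (hcosh p w) (hcosh z w); first by rewrite /= sfix//; lra.
  exfalso; apply: nW; split; first by split => //; rewrite lt_neqAle wk'.
  by rewrite /= LT// lt_neqAle eq_sym Lw0 -LE.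
- move=> w [[w0 wk] /= Lw]; have [Dv Ev _] := hv w (conj w0 wk).
  have /hv[Ds Es _] : hdisc p k (s w).
    split; first exact: sH.
    by rewrite Cs//; apply: lt_trans wk; rewrite -LT.
  have [Dvs Evs] := sl v w w0 Ds; split; first by have [] := D2_lin 1 (- 1) Dvs Dv.
  by rewrite (hlap_lin _ _ Dvs Dv) Evs; exact: (sub_eq _ _ _ _ _ Ev Es).
- by move=> w /WK/Kc /hg[Dw Ew _]; split; [exact: Dw|rewrite Ew].
- exact: Wz.
Qed.

End eigenfunction_centre.

(** * Separation of a vertical strip by parity of crossings *)

Section separation.
Context {R : realType}.
Implicit Types (x y z w : R * R) (U K : set (R * R)).

(** The upward ray sweeps over the endpoint [x] when its base point passes under [x] from one side
    to the other; only then may an endpoint alter the parity. The half-open comparison fixes the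
    side of points exactly under [x]. *)
Definition jump x z w : bool := (z.2 < x.2) && ((x.1 <= w.1) (+) (x.1 <= z.1)).

(* [crossing U x y]: a compact subset [K] of [U], the trace of a path from [x] to
   [y], with the parity [N z] of the number of its crossings with the vertical ray
   above [z]. Away from [K] the parity changes only below the endpoints. *)
Definition crossing U x y := exists K (N : R * R -> bool) (m M : R),
  [/\ compact K /\ K `<=` U, 0 < m /\ forall z, K z -> m <= z.2,
   forall z, ~ K z -> \forall w \near z, N w (+) N z = jump x z w (+) jump y z w,
   forall z, M < z.2 -> N z = false &
   forall z, z.2 < m -> N z = (x.1 <= z.1) (+) (y.1 <= z.1)].

(** Parities add up, and the two jumps at the middle point cancel. *)
Lemma crossing_trans U x y z : crossing U x y -> crossing U y z -> crossing U x z.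
Proof.
move=> [K1 [N1 [m1 [M1 [[c1 s1] [p1 l1] j1 h1 b1]]]]].
move=> [K2 [N2 [m2 [M2 [[c2 s2] [p2 l2] j2 h2 b2]]]]].
exists (K1 `|` K2), (fun w => N1 w (+) N2 w), (Num.min m1 m2), (Num.max M1 M2).
split.
- by split; [exact: compactU|move=> w []; [exact: s1|exact: s2]].
- split; first by rewrite lt_min p1.
  by move=> w [/l1|/l2] h; rewrite ge_min h ?orbT.
- move=> w nK.
  have n1 : ~ K1 w by move=> ?; apply: nK; left.
  have n2 : ~ K2 w by move=> ?; apply: nK; right.
  apply: filterS2 (j1 _ n1) (j2 _ n2) => t e1 e2.
  by rewrite addbACA e1 e2; case: (jump x w t); case: (jump y w t); case: (jump z w t).
- by move=> w; rewrite gt_max => /andP[/h1 -> /h2 ->].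
- by move=> w; rewrite lt_min => /andP[/b1 -> /b2 ->]; case: (x.1 <= _); case: (y.1 <= _); case: (z.1 <= _).
Qed.

Lemma near_le_fst (a : R) z : a != z.1 -> \forall w \near z, (a <= w.1) = (a <= z.1).
Proof.
move=> az; have [az'|az'] := leP a z.1.
  have : \forall w \near z, a < w.1.
    by apply: (@cont_lt _ _ (fun=> a) fst); [cont|cont|rewrite lt_neqAle az].
  by apply: filterS => w /ltW.
have : \forall w \near z, w.1 < a.
  by apply: (@cont_lt _ _ fst (fun=> a)); [cont|cont|].
by apply: filterS => w; rewrite ltNge => /negbTE.
Qed.

(** Under the half-open convention a vertical segment has parity 0 everywhere. A point of its line
    off the segment is below both endpoints or above both, so that their jumps cancel. *)
Lemma crossing_vertical U x y : x.1 = y.1 -> 0 < x.2 -> 0 < y.2 ->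
  (forall z, z.1 = x.1 -> Num.min x.2 y.2 <= z.2 -> z.2 <= Num.max x.2 y.2 -> U z) ->
  crossing U x y.
Proof.
move=> xy x0 y0 hU.
exists ([set x.1] `*` `[Num.min x.2 y.2, Num.max x.2 y.2]%classic), (fun=> false),
  (Num.min x.2 y.2), 0; split.
- split; first by apply: compact_setX; [exact: compact_set1|exact: segment_compact].
  by move=> z [/= z1]; rewrite in_itv/= => /andP[? ?]; exact: hU.
- split; first by rewrite lt_min x0.
  by move=> z [/= _]; rewrite in_itv/= => /andP[].
- move=> z nK; have [z1|z1] := eqVneq x.1 z.1; last first.
    have := near_le_fst z1; apply: filterS => w e.
    by rewrite /jump -xy e; case: (x.1 <= z.1); rewrite !andbF.
  have E : (z.2 < x.2) = (z.2 < y.2).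
    move: nK; rewrite /= in_itv/= => nK; have {}nK : ~~ (Num.min x.2 y.2 <= z.2 <= Num.max x.2 y.2).
      by apply/negP => h; apply: nK.
    move: nK; rewrite ge_min le_max.
    by case: (ltP z.2 x.2); case: (ltP z.2 y.2) => // h1 h2;
      rewrite ?h1 ?h2 ?(ltW h1) ?(ltW h2) ?orbT.
  apply: filterS (@filterT _ (nbhs z) _) => w _; by rewrite /jump E -xy; case: (_ && _).
- by [].
- by move=> z _; rewrite xy addbb.
Qed.

Lemma crossing_horizontal U x y : x.2 = y.2 -> 0 < x.2 ->
  (forall z, z.2 = x.2 -> Num.min x.1 y.1 <= z.1 -> z.1 <= Num.max x.1 y.1 -> U z) ->
  crossing U x y.
Proof.
move=> xy x0 hU.
exists (`[Num.min x.1 y.1, Num.max x.1 y.1]%classic `*` [set x.2]),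
  (fun z => (z.2 < x.2) && ((x.1 <= z.1) (+) (y.1 <= z.1))), x.2, x.2; split.
- split; first by apply: compact_setX; [exact: segment_compact|exact: compact_set1].
  by move=> z [/=]; rewrite in_itv/= => /andP[? ?] z2; exact: hU.
- by split => // z [/= _ ->].
- move=> z nK; rewrite /jump -xy; have [z2|z2|z2] := ltgtP z.2 x.2.
  + have : \forall w \near z, w.2 < x.2 by apply: (@cont_lt _ _ snd (fun=> x.2)); [cont|cont|].
    by apply: filterS => w -> /=; rewrite addbACA.
  + have : \forall w \near z, x.2 < w.2 by apply: (@cont_lt _ _ (fun=> x.2) snd); [cont|cont|].
    by apply: filterS => w h; rewrite ltNge (ltW h).
  + have nz : ~~ (Num.min x.1 y.1 <= z.1 <= Num.max x.1 y.1).
      by apply/negP => h; apply: nK; split => //=; rewrite in_itv.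
    have [nx ny] : x.1 != z.1 /\ y.1 != z.1.
      split; apply: contraNN nz => /eqP <-; rewrite ge_min le_max !lexx/= ?orbT//.
    apply: filterS2 (near_le_fst nx) (near_le_fst ny) => w -> -> /=.
    rewrite addbF; apply/negbTE; move: nz; rewrite ge_min le_max negb_and.
    by case: (leP x.1 z.1); case: (leP y.1 z.1) => // h1 h2;
      rewrite ?(ltW h1) ?(ltW h2) ?orbT /= ?andbF.
- by move=> z /ltW; rewrite leNgt => /negbTE ->.
- by move=> z ->.
Qed.

Lemma crossing_box U z (r : R) x y : U `<=` @H2 R -> box z r `<=` U ->
  box z r x -> box z r y -> crossing U x y.
Proof.
move=> UH BU Bx By; have Ux := UH _ (BU _ Bx); have Uy := UH _ (BU _ By).
move/boxP: Bx => [a1 a2 a3 a4]; move/boxP: By => [b1 b2 b3 b4].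
apply: (@crossing_trans _ _ (y.1, x.2)).
- apply: crossing_horizontal => //= w w2; rewrite ge_min le_max => h1 h2.
  apply: BU; apply/boxP; rewrite w2; split => //.
    by case/orP: h1 => h; lra.
  by case/orP: h2 => h; lra.
- apply: crossing_vertical => //= w w1; rewrite ge_min le_max => h1 h2.
  apply: BU; apply/boxP; rewrite w1; split => //.
    by case/orP: h1 => h; lra.
  by case/orP: h2 => h; lra.
Qed.

(** The points that a crossing joins to [x] form an open and closed subset of [U], since two
    segments join any two points of a box. Connectedness thus suffices, and no path has to be
    built. *)
Lemma crossing_connected U x y : open U -> connected U -> U `<=` @H2 R ->
  U x -> U y -> crossing U x y.
Proof.
move=> oU cU UH Ux Uy.
have loc z : U z -> \forall t \near z, U t /\ (crossing U x z <-> crossing U x t).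
  move=> Uz; have [r r0 hr] := nbhs_box (open_nbhs_nbhs (conj oU Uz)).
  have Bz : box z r z by apply/boxP; split; lra.
  have nz : \forall t \near z, box z r t by apply: box_nbhs; lra.
  apply: filterS nz => t Bt; split; first exact: hr.
  by split => h; apply: crossing_trans h _; exact: (crossing_box UH hr).
pose B := [set z | U z /\ crossing U x z].
suff UB : U = B by have [] : B y by rewrite -UB.
apply/esym/cU.
- by exists x; split => //; have [r r0 hr] := nbhs_box (open_nbhs_nbhs (conj oU Ux));
    apply: (crossing_box (z := x) UH hr); apply/boxP; split; lra.
- exists B; last by apply/seteqP; split => [z [Uz ?]|z []].
  by rewrite openE => z [Uz cz]; apply: filterS (loc z Uz) => t [Ut h]; split => //; apply/h.
- exists (~` [set z | U z /\ ~ crossing U x z]).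
    apply: open_closedC; rewrite openE => z [Uz cz].
    by apply: filterS (loc z Uz) => t [Ut h]; split => // /h.
  apply/seteqP; split => z.
    by move=> [Uz cz]; split => // -[].
  by move=> [Uz nz]; split => //; apply: contrapT => h; apply: nz.
Qed.

(** The endpoints lie on the two sides of the strip, so that no jump occurs inside and the parity is
    locally constant off [K]; [A] is its odd part. Far below, one endpoint is to the left and the
    other is not, so the parity is odd there. *)
Lemma strip_separation U (e b1 b2 : R) : open U -> connected U -> U `<=` @H2 R ->
  U (- e, b1) -> U (e, b2) -> exists K A (m M : R),
  [/\ compact K /\ K `<=` U, open A /\ (forall z, A z -> z.2 <= M),
   forall z, closure A z -> - e < z.1 < e -> A z \/ K z, 0 < m &
   forall z, z.2 < m -> - e < z.1 < e -> A z].
Proof.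
move=> oU cU UH Ux Uy.
have [K [N [m [M [[cK sK] [m0 mK] j h l]]]]] := crossing_connected oU cU UH Ux Uy.
have clK := compact_closed (@norm_hausdorff _ _) cK.
have jN z : ~ K z -> - e < z.1 < e -> \forall w \near z,
    [/\ ~ K w, - e < w.1 < e & N w = N z].
  move=> nK ze; have /andP[z1 z2] := ze.
  have n1 : \forall w \near z, - e < w.1 by apply: (@cont_lt _ _ (fun=> - e) fst); [cont|cont|].
  have n2 : \forall w \near z, w.1 < e by apply: (@cont_lt _ _ fst (fun=> e)); [cont|cont|].
  have n3 : \forall w \near z, ~ K w.
    by apply: (open_nbhs_nbhs (conj _ nK)); exact: closed_openC.
  have n4 := j _ nK.
  near=> w; have w1 : - e < w.1 by near: w.
  have w2 : w.1 < e by near: w.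
  split; [by near: w|by rewrite w1|].
  have : N w (+) N z = jump (- e, b1) z w (+) jump (e, b2) z w by near: w.
  rewrite /jump/= (ltW w1) (ltW z1) !leNgt w2 z2 /= !andbF /=.
  by case: (N w); case: (N z).
exists K, [set z | [/\ ~ K z, - e < z.1 < e & N z]], m, M; split => //.
- split.
    rewrite openE => z [nK ze Nz]; apply: filterS (jN _ nK ze) => w [? ? E].
    by split => //; rewrite E.
  by move=> z [_ _ Nz]; rewrite leNgt; apply/negP => /h; rewrite Nz.
- move=> z cz ze; have [Kz|nK] := pselect (K z); [by right|left].
  by have [w [[_ _ Nw] [_ _ E]]] := cz _ (jN _ nK ze); split => //; rewrite -E.
- move=> z zm ze; split => //; first by move=> /mK; rewrite leNgt zm.
  by have /andP[z1 z2] := ze; rewrite l//= (ltW z1) leNgt z2.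
Unshelve. all: by end_near. Qed.

End separation.

Lemma cont_comp (T U V : topologicalType) (f : T -> U) (h : U -> V) (x : T) :
  {for x, continuous f} -> {for f x, continuous h} ->
  {for x, continuous (fun y => h (f y))}.
Proof. by move=> hf hh; exact: (cvg_comp _ _ hf hh). Qed.

(** * Coordinates adapted to the geodesic that carries the centres *)

Section axis.
Context {R : realType}.
Variables (g : R * R -> R * R) (m0 : R).
Hypotheses (hg : hisometry g) (gK : forall z, H2 z -> g (g z) = z).
Implicit Types (z q : R * R) (t k : R).

Definition axis t := g (m0, t).

(* [(strip z).1] is the hyperbolic sine of the signed distance from [z] to the axis. *)
Definition strip z : R * R := (((g z).1 - m0) / (g z).2, (g z).2^-1).
Definition unstrip q : R * R := g (m0 + q.1 / q.2, q.2^-1).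

Let gH z : H2 z -> H2 (g z). Proof. by case: hg => h _ _ _; exact: h. Qed.

Lemma axis_H2 t : 0 < t -> H2 (axis t).
Proof. by move=> t0; apply: gH. Qed.

Lemma axis_hcosh t z : 0 < t -> H2 z -> hcosh (axis t) z = hcosh (m0, t) (g z).
Proof.
by move=> t0 z0; have [_ h _ _] := hg; rewrite -[in LHS](gK z0) h//; exact: gH.
Qed.

Lemma axis_continuous t : 0 < t -> {for t, continuous axis}.
Proof.
move=> t0; have [_ _ h _] := hg.
by apply: (@cont_comp _ _ _ (fun t => (m0, t)) g); [cont|exact: h].
Qed.

Lemma strip_H2 z : H2 z -> H2 (strip z).
Proof. by move=> z0; rewrite /H2 /strip/= invr_gt0; exact: gH. Qed.

Lemma stripK z : H2 z -> unstrip (strip z) = z.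
Proof.
move=> z0; have gz0 : 0 < (g z).2 := gH z0.
rewrite /unstrip /strip/= invrK divfK ?gt_eqF// addrC subrK -surjective_pairing.
exact: gK.
Qed.

Lemma unstripK q : H2 q -> strip (unstrip q) = q.
Proof.
move=> q0; have q0' : 0 < q.2 := q0.
rewrite /strip /unstrip gK; last by rewrite /H2/= invr_gt0.
by rewrite /= addrAC subrr add0r invrK divfK ?gt_eqF// -surjective_pairing.
Qed.

Lemma strip_continuous z : H2 z -> {for z, continuous strip}.
Proof.
move=> z0; have [_ _ h _] := hg; have gc := h _ z0.
have gz0 : (g z).2 != 0 by rewrite gt_eqF//; exact: gH.
by rewrite /strip; cont.
Qed.

Lemma unstrip_continuous q : H2 q -> {for q, continuous unstrip}.
Proof.
move=> q0; have [_ _ h _] := hg; have q0' : q.2 != 0 by rewrite gt_eqF.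
apply: (@cont_comp _ _ _ (fun q : R * R => (m0 + q.1 / q.2, q.2^-1)) g); first by cont.
by apply: h; rewrite /H2/= invr_gt0.
Qed.

(** A point of the axis is at least as far from [z] as the axis itself. The gap between the two
    sides is a square over a square, zero when [axis t] is the foot of the perpendicular. *)
Lemma axis_hcosh_ge t z : 0 < t -> H2 z ->
  1 + (strip z).1 ^+ 2 <= hcosh (axis t) z ^+ 2.
Proof.
move=> t0 z0; rewrite axis_hcosh// /strip/= /hcosh/=.
have : 0 < (g z).2 := gH z0; case: (g z) => a y /= y0.
pose s := (a - m0) / y; have -> : m0 - a = - (s * y) by rewrite /s divfK ?gt_eqF// opprB.
rewrite -/s.
have -> : 1 + ((- (s * y)) ^+ 2 + (t - y) ^+ 2) / (2 * t * y) =
  ((1 + s ^+ 2) * y ^+ 2 + t ^+ 2) / (2 * t * y) by field; rewrite !gt_eqF.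
move: s => s; rewrite [X in _ <= X]expr_div_n ler_pdivlMr ?exprn_gt0 ?mulr_gt0// -subr_ge0.
have -> : ((1 + s ^+ 2) * y ^+ 2 + t ^+ 2) ^+ 2 - (1 + s ^+ 2) * (2 * t * y) ^+ 2 =
  ((1 + s ^+ 2) * y ^+ 2 - t ^+ 2) ^+ 2 by ring.
exact: sqr_ge0.
Qed.

Lemma axis_disc_strip t k z e : 0 < t -> 1 <= k -> 0 < e -> k ^+ 2 - 1 < e ^+ 2 ->
  hdiscbar (axis t) k z ->
  [/\ - e < (strip z).1 < e, (g z).2 <= (1 + 2 * k) * t & t <= 2 * k * (g z).2].
Proof.
move=> t0 k1 e0 ke [z0 zk].
have h := axis_hcosh_ge t0 z0; have h1 := hcosh_ge1 (axis_H2 t0) z0.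
have s2 : (strip z).1 ^+ 2 < e ^+ 2 by nra.
have [] := @hdiscbar_box _ (m0, t) k (g z); rewrite //=.
  by split; [exact: gH|rewrite -axis_hcosh].
move=> /boxP[_ _ _ b] c; split => //; last by move: b => /=; lra.
by rewrite -ltr_norml -(@ltr_pXn2r _ 2%N)// ?nnegrE ?normr_ge0 ?(ltW e0)// real_normK// num_real.
Qed.

(** The hypothesis on [a / b] says that [x] and [y] are at distance at least the radius from the
    axis, on opposite sides. The second strip coordinate is the inverse of a height, so that the
    part lying below in the strip is the one that discs with large [t] fill. *)
Lemma axis_separation (k a b : R) (U : set (R * R)) x y : 1 < k -> 0 < b -> 0 <= a ->
  (k ^+ 2 - 1) * b ^+ 2 <= a ^+ 2 -> open U -> connected U -> U `<=` @H2 R ->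
  U x -> U y -> g x = (m0 - a, b) -> g y = (m0 + a, b) ->
  exists K A, [/\ compact K /\ K `<=` U, open A /\ A `<=` @H2 R,
    forall t z, 0 < t -> hdiscbar (axis t) k z -> closure A z -> A z \/ K z,
    exists2 t : R, 0 < t & forall z, A z -> ~ hdisc (axis t) k z &
    exists2 t : R, 0 < t & hdiscbar (axis t) k `<=` A].
Proof.
move=> k1 b0 a0 kab oU cU UH Ux Uy gx gy.
pose V := strip @` U.
have VE q : V q <-> H2 q /\ U (unstrip q).
  split; first by move=> [z Uz <-]; have z0 := UH _ Uz; rewrite stripK//; split => //; exact: strip_H2.
  by move=> [q0 Uq]; exists (unstrip q) => //; exact: unstripK.
have oV : open V.
  rewrite openE => q /VE[q0 Uq].
  have n1 := open_nbhs_nbhs (conj (@open_H2 R) q0).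
  have n2 : \forall r \near q, U (unstrip r).
    exact: (unstrip_continuous q0 (open_nbhs_nbhs (conj oU Uq))).
  by apply: filterS2 n1 n2 => r r0 Ur; apply/VE.
have cV : connected V.
  apply: connected_continuous_connected => //.
  by apply: continuous_in_subspaceT => z; rewrite inE => /UH /strip_continuous.
have VH : V `<=` @H2 R by move=> q /VE[].
have sx : strip x = (- (a / b), b^-1).
  by rewrite /strip gx/=; congr pair; rewrite addrAC subrr add0r mulNr.
have sy : strip y = (a / b, b^-1).
  by rewrite /strip gy/=; congr pair; rewrite addrAC subrr add0r.
have Vx : V (strip x) by exists x.
have Vy : V (strip y) by exists y.
have [r1 r10 hr1] := nbhs_box (open_nbhs_nbhs (conj oV Vx)).
have [r2 r20 hr2] := nbhs_box (open_nbhs_nbhs (conj oV Vy)).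
(* As [V] is open, the endpoints can be moved outwards by [d]: closed discs then stay strictly
   inside the strip even when [a / b] equals the hyperbolic sine of the radius. *)
pose d := Num.min r1 r2; have d0 : 0 < d by rewrite /d lt_min r10.
have [d1 d2] : d <= r1 /\ d <= r2 by rewrite /d !ge_min !lexx orbT.
have ab0 : 0 <= a / b by rewrite divr_ge0// ltW.
pose e := a / b + d; have e0 : 0 < e by rewrite /e ltr_wpDl.
have ke : k ^+ 2 - 1 < e ^+ 2.
  have : k ^+ 2 - 1 <= (a / b) ^+ 2 by rewrite expr_div_n ler_pdivlMr// exprn_gt0.
  by rewrite /e; nra.
have Vx' : V (- e, b^-1) by apply: hr1; rewrite sx; apply/boxP; rewrite /= /e; split; lra.
have Vy' : V (e, b^-1) by apply: hr2; rewrite sy; apply/boxP; rewrite /= /e; split; lra.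
have [K [A [m [M [[cK sK] [oA AM] clA m_gt0 lowA]]]]] := strip_separation oV cV VH Vx' Vy'.
have k1' := ltW k1.
exists (unstrip @` K), [set z | H2 z /\ A (strip z)]; split.
- split.
    apply: continuous_compact => //; apply: continuous_in_subspaceT => q.
    by rewrite inE => /sK/VH; exact: unstrip_continuous.
  by move=> _ [q /sK /VE[_ Uq] <-].
- split; last by move=> z [].
  rewrite openE => z [z0 Az]; have n1 := open_nbhs_nbhs (conj (@open_H2 R) z0).
  have n2 := strip_continuous z0 (open_nbhs_nbhs (conj oA Az)).
  by apply: filterS2 n1 n2 => r r0 Ar; split.
- move=> t z t0 zk cz; have z0 := zk.1.
  have [se _ _] := axis_disc_strip t0 k1' e0 ke zk.
  have [|Az|Kz] := clA (strip z) _ se.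
  + move=> B nB; have [r [[r0 Ar] Br]] := cz _ (strip_continuous z0 nB).
    by exists (strip r).
  + by left.
  + by right; exists (strip z) => //; exact: stripK.
- pose N := Num.max M 1; have N0 : 0 < N by rewrite /N lt_max ltr01 orbT.
  have NM : M <= N by rewrite /N le_max lexx.
  (* The disc stays below height [(1 + 2 * k) * t], here [(2 * N)^-1], so its second strip
     coordinate is at least [2 * N], above [M]. *)
  exists (((1 + 2 * k) * (2 * N))^-1).
    by rewrite invr_gt0 !mulr_gt0// addr_gt0// mulr_gt0//; lra.
  set t := _^-1 => z [z0 Az] [_ /ltW zk].
  have t0 : 0 < t by rewrite invr_gt0 !mulr_gt0// addr_gt0// mulr_gt0//; lra.
  have [_ zt _] := axis_disc_strip t0 k1' e0 ke (conj z0 zk).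
  have tE : (1 + 2 * k) * t = (2 * N)^-1.
    by rewrite /t invfM mulrA mulfV ?mul1r// gt_eqF//; lra.
  have := AM _ Az; rewrite /strip/= => zM.
  have gz0 : 0 < (g z).2 := gH z0.
  have : 1 <= N * (g z).2.
    by rewrite -ler_pdivrMr// div1r (le_trans zM).
  have : N * (g z).2 <= N * (2 * N)^-1 by rewrite ler_pM2l// -tE.
  have -> : N * (2 * N)^-1 = 1 / 2 by field; rewrite gt_eqF.
  by lra.
(* The disc stays above height [t / (2 * k)], here [2 / m], so its second strip coordinate is at
   most [m / 2]. *)
- have t0 : 0 < 4 * k / m by rewrite divr_gt0// mulr_gt0//; lra.
  exists (4 * k / m) => // z zk; have z0 := zk.1; split => //.
  have [se _ tz] := axis_disc_strip t0 k1' e0 ke zk.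
  apply: lowA => //; rewrite /strip/=.
  have gz0 : 0 < (g z).2 := gH z0.
  have : 2 <= m * (g z).2.
    move: tz; rewrite ler_pdivrMr//; nra.
  by rewrite -div1r ltr_pdivrMr//; lra.
Qed.

End axis.

(** * First-order behaviour along rays entering a domain *)

Section boundary_slope.
Context {R : realType}.
Implicit Types (z n p c : R * R) (u v : R * R -> R) (D : set (R * R)).

Definition ray z n (t : R) : R * R := (z.1 + t * n.1, z.2 + t * n.2).

Lemma ray0 z n : ray z n 0 = z.
Proof. by rewrite /ray !mul0r !addr0 -surjective_pairing. Qed.

Lemma ray_continuous z n (t : R) : {for t, continuous (ray z n)}.
Proof. by rewrite /ray; cont. Qed.

Lemma is_derive_ray u z n (t : R) : differentiable u (ray z n t) ->
  is_derive t 1 (fun s => u (ray z n s))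
    (n.1 * pdx u (ray z n t) + n.2 * pdy u (ray z n t)).
Proof.
have h (a b : R) : is_derive t (1 : R) (fun s : R => a + s * b) b.
  apply: is_derive_eq (is_derive_add (is_derive_const a t (1 : R))
    (is_derive_mul (is_derive_id t (1 : R)) (is_derive_const b t (1 : R)))) _.
  by ring.
by move=> du; exact: (is_derive_curve (a := fun s => z.1 + s * n.1)
  (b := fun s => z.2 + s * n.2) du (h _ _) (h _ _)).
Qed.

Definition overdetermined D u (alpha : R) := [/\ D `<=` @H2 R,
  forall y, D y -> differentiable u y, {within hclosure D, continuous u},
  forall z, hbdry D z -> u z = 0 & normal_deriv_eq D u alpha].

Lemma near_right_itv (P : R -> Prop) : (\forall t \near 0^'+, P t) ->
  exists2 d : R, 0 < d & forall t, 0 < t -> t < d -> P t.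
Proof.
move=> [d /= d0 h]; exists d => // t t0 td; apply: h => //=.
by rewrite sub0r normrN gtr0_norm.
Qed.

(** [u] need not be differentiable at the boundary point [z]; the mean value theorem on the ray and
    the continuous extension of the gradient replace its expansion there. *)
Lemma slope_along D u z n gx gy : D `<=` @H2 R ->
  (forall y, D y -> differentiable u y) -> {within hclosure D, continuous u} ->
  extends_cont D (pdx u) gx -> extends_cont D (pdy u) gy -> hclosure D z ->
  u z = 0 -> (\forall t \near 0^'+, D (ray z n t)) ->
  forall e : R, 0 < e -> \forall t \near 0^'+,
    `|u (ray z n t) - (n.1 * gx z + n.2 * gy z) * t| <= e * t.
Proof.
move=> DH du cu [cgx ex] [cgy ey] Dz uz /near_right_itv[d d0 hd] e e0.
have Dcl y : D y -> hclosure D y.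
  by move=> Dy; split; [apply: subset_closure; exact: Dy|apply: DH; exact: Dy].
pose G y := n.1 * gx y + n.2 * gy y.
have cG : G y @[y --> within (hclosure D) (nbhs z)] --> G z.
  have h1 := (subspace_continuousP _ gx).1 cgx z Dz.
  have h2 := (subspace_continuousP _ gy).1 cgy z Dz.
  exact: (cvgD (cvgM (cvg_cst n.1) h1) (cvgM (cvg_cst n.2) h2)).
have [d' d'0 hd'] : exists2 d' : R, 0 < d' & forall t, 0 < t -> t < d' ->
    hclosure D (ray z n t) -> `|G (ray z n t) - G z| < e.
  apply: near_right_itv.
  have /cvgrPdist_lt/(_ _ e0) := cG; rewrite near_withinE => ne.
  have ne' : \forall y \near ray z n 0, hclosure D y -> `|G z - G y| < e by rewrite ray0.
  have H : nbhs (0 : R) (fun t => hclosure D (ray z n t) -> `|G z - G (ray z n t)| < e).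
    exact: (@ray_continuous z n 0 _ ne').
  by rewrite near_withinE; apply: filterS H => t h _ ht; rewrite distrC; exact: h.
pose d2 := Num.min d d'; have d20 : 0 < d2 by rewrite /d2 lt_min d0.
have [dd dd'] : d2 <= d /\ d2 <= d' by rewrite /d2 !ge_min !lexx orbT.
near=> t.
have t0 : 0 < t by near: t; exact: nbhs_right_gt.
have td : t < d2 by near: t; exact: nbhs_right_lt.
have hD s : 0 < s -> s <= t -> D (ray z n s) by move=> s0 st; apply: hd => //; lra.
have [||s] := @MVT _ (fun s => u (ray z n s))
   (fun s => n.1 * pdx u (ray z n s) + n.2 * pdy u (ray z n s)) 0 t t0.
- move=> s; rewrite in_itv/= => /andP[s0 st].
  by apply: is_derive_ray; apply: du; apply: hD => //; exact: ltW.
- apply/subspace_continuousP => s; rewrite /= in_itv/= => /andP[s0 st].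
  apply: (@within_comp _ _ _ _ (hclosure D) (ray z n) u s); last exact: cu.
  + move=> r; rewrite /= in_itv/= => /andP[r0 rt].
    have [->|rn0] := eqVneq r 0; first by rewrite ray0.
    by apply/Dcl/hD => //; rewrite lt_neqAle eq_sym rn0.
  + by rewrite /= in_itv/= s0.
  + exact: ray_continuous.
rewrite in_itv/= => /andP[s0 st]; rewrite ray0 uz !subr0 => ->.
have Ds := hD _ s0 (ltW st).
rewrite -ex// -ey// -mulrBl normrM (gtr0_norm t0) ler_wpM2r ?(ltW t0)// ltW//.
by apply: hd' => //; [lra|exact: Dcl].
Unshelve. all: by end_near. Qed.

(** Here [n] is an inner normal of arbitrary length. The hyperbolic unit normal is the Euclidean one
    times the height, whence the factor |n| / z_2. *)
Lemma normal_slope D u (alpha k0 : R) z n (U : set (R * R)) phi :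
  overdetermined D u alpha -> hbdry D z -> local_defining D z U phi -> 0 < k0 ->
  0 < n.1 ^+ 2 + n.2 ^+ 2 -> pdx phi z = - (k0 * n.1) -> pdy phi z = - (k0 * n.2) ->
  (\forall t \near 0^'+, D (ray z n t)) -> forall e : R, 0 < e ->
  \forall t \near 0^'+, `|u (ray z n t) -
     (- alpha * Num.sqrt (n.1 ^+ 2 + n.2 ^+ 2) / z.2) * t| <= e * t.
Proof.
move=> [DH du cu bu [gx [gy [egx egy hn]]]] bz ld k00 n0 ex ey nD e e0.
have z0 : 0 < z.2 by case: bz.
have := hn _ _ _ bz ld; rewrite ex ey.
have -> : (- (k0 * n.1)) ^+ 2 + (- (k0 * n.2)) ^+ 2 = k0 ^+ 2 * (n.1 ^+ 2 + n.2 ^+ 2) by ring.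
rewrite sqrtrM ?sqr_ge0// sqrtr_sqr (gtr0_norm k00).
set N := Num.sqrt _ => E; have N0 : 0 < N by rewrite sqrtr_gt0.
have -> : - alpha * N / z.2 = n.1 * gx z + n.2 * gy z.
  by rewrite -E; field; rewrite !gt_eqF.
have zcl : hclosure D z by case: bz => -[].
exact: (slope_along DH du cu egx egy zcl (bu _ bz) nD e0).
Qed.

(** A geodesic disc is the Euclidean disc of centre [(c.1, c.2 * k)] and radius c_2 sqrt (k^2 - 1);
    [inward] below points to this centre. *)
Definition disc_poly c (k : R) (w : R * R) : R :=
  (w.1 - c.1) ^+ 2 + (w.2 - c.2 * k) ^+ 2 - c.2 ^+ 2 * (k ^+ 2 - 1).

Lemma hcosh_disc_poly c (k : R) w : H2 c -> H2 w -> (hcosh c w < k) = (disc_poly c k w < 0).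
Proof.
move=> c0 w0; rewrite hcosh_lt// -subr_lt0; congr (_ < 0); rewrite /disc_poly; ring.
Qed.

Lemma hcosh_disc_poly0 c (k : R) w : H2 c -> H2 w -> hcosh c w = k -> disc_poly c k w = 0.
Proof.
rewrite /H2/= => c0 w0 <-; rewrite /hcosh /disc_poly; field.
by rewrite !gt_eqF.
Qed.

Definition inward c (k : R) z : R * R := (c.1 - z.1, c.2 * k - z.2).

Lemma disc_poly_ray c (k : R) z m (t : R) : disc_poly c k (ray z m t) =
  disc_poly c k z - t * (2 * (m.1 * (inward c k z).1 + m.2 * (inward c k z).2)
   - t * (m.1 ^+ 2 + m.2 ^+ 2)).
Proof. by rewrite /disc_poly /ray /inward/=; ring. Qed.

Lemma ray_hdisc c (k : R) z m : H2 c -> H2 z -> hcosh c z = k ->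
  0 < m.1 * (inward c k z).1 + m.2 * (inward c k z).2 ->
  \forall t \near 0^'+, hdisc c k (ray z m t).
Proof.
move=> c0 z0 zk; set P := _ + _ => P0.
have nH : \forall t \near 0^'+, H2 (ray z m t).
  rewrite near_withinE.
  have H : nbhs (0 : R) (fun t => H2 (ray z m t)).
    by apply: ray_continuous; rewrite ray0; exact: open_nbhs_nbhs (conj (@open_H2 R) z0).
  by apply: filterS H.
pose M := 1 + (m.1 ^+ 2 + m.2 ^+ 2); have M0 : 0 < M.
  by rewrite /M ltr_pwDl// addr_ge0// sqr_ge0.
near=> t.
have t0 : 0 < t by near: t; exact: nbhs_right_gt.
have tP : t < P / M by near: t; apply: nbhs_right_lt; rewrite divr_gt0.
have zt : H2 (ray z m t) by near: t.
split => //; rewrite hcosh_disc_poly// disc_poly_ray (hcosh_disc_poly0 c0 z0 zk) -/P.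
rewrite sub0r oppr_lt0 mulr_gt0//.
move: tP; rewrite ltr_pdivlMr// /M; nra.
Unshelve. all: by end_near. Qed.

Lemma inward_norm c (k : R) z : H2 c -> H2 z -> hcosh c z = k ->
  (inward c k z).1 ^+ 2 + (inward c k z).2 ^+ 2 = c.2 ^+ 2 * (k ^+ 2 - 1).
Proof.
move=> c0 z0 zk; apply/eqP; rewrite -subr_eq0 -(hcosh_disc_poly0 c0 z0 zk).
by apply/eqP; rewrite /inward /disc_poly/=; ring.
Qed.

Lemma nonincreasing_ray (phi : R * R -> R) z m : differentiable phi z ->
  (\forall t \near 0^'+, phi (ray z m t) <= phi z) ->
  m.1 * pdx phi z + m.2 * pdy phi z <= 0.
Proof.
move=> dphi hphi; rewrite leNgt; apply/negP.
have := @is_derive_ray phi z m 0; rewrite ray0 => /(_ dphi) [dr Er].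
rewrite -{}Er => L0.
have H : \forall t \near 0^', 0 < t^-1 * (phi (ray z m t) - phi z).
  have := dr [set r | 0 < r] (open_nbhs_nbhs (conj (@open_gt R 0) L0)).
  rewrite !near_simpl /= => H; near=> t.
  have : 0 < t^-1 *: (phi (ray z m (t *: 1 + 0)) - phi (ray z m 0)) by near: t.
  by rewrite ray0 addr0 [t *: 1]mulr1.
have [d d0 hd] : exists2 d : R, 0 < d & forall t, 0 < t -> t < d ->
    0 < t^-1 * (phi (ray z m t) - phi z).
  case: H => d /= d0 hd; exists d => // t t0 td; apply: hd => /=.
    by rewrite sub0r normrN gtr0_norm.
  by rewrite gt_eqF.
have [d' d'0 hd'] := near_right_itv hphi.
pose t := Num.min d d' / 2.
have mn : 0 < Num.min d d' by rewrite lt_min d0.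
have [md md'] : Num.min d d' <= d /\ Num.min d d' <= d' by rewrite !ge_min !lexx orbT.
have t0 : 0 < t by rewrite /t divr_gt0.
have h1 := hd _ t0 (_ : t < d); have h2 := hd' _ t0 (_ : t < d').
have : 0 < t^-1 * (phi (ray z m t) - phi z) by apply: h1; rewrite /t; lra.
rewrite pmulr_rgt0 ?invr_gt0// subr_gt0 ltNge h2// /t; lra.
Unshelve. all: by end_near. Qed.

(** [phi] cannot exceed its value at [z] in any direction entering the disc. A linear form that is
    nonpositive on an open half-plane is a nonpositive multiple of the normal, and this one is not
    zero. *)
Lemma disc_tangent_normal D c (k : R) z U phi : H2 c -> H2 z -> hcosh c z = k ->
  1 < k -> (\forall w \near z, hdisc c k w -> D w) -> ~ D z ->
  local_defining D z U phi ->
  exists2 k0 : R, 0 < k0 & pdx phi z = - (k0 * (inward c k z).1) /\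
    pdy phi z = - (k0 * (inward c k z).2).
Proof.
move=> c0 z0 zk k1 nD nDz [oU [Uz [UH [cphi [gphi Dphi]]]]].
have dphi : differentiable phi z by have [] := cphi _ Uz.
have phz : 0 <= phi z by rewrite leNgt; apply/negP => /(Dphi _ Uz).
set n := inward c k z.
have n2 : 0 < n.1 ^+ 2 + n.2 ^+ 2.
  by rewrite inward_norm// mulr_gt0 ?exprn_gt0// subr_gt0 exprn_egt1.
have key m : 0 < m.1 * n.1 + m.2 * n.2 -> m.1 * pdx phi z + m.2 * pdy phi z <= 0.
  move=> mn; apply: nonincreasing_ray => //.
  have nd := ray_hdisc c0 z0 zk mn.
  have nU : \forall t \near 0^'+, U (ray z m t) /\ (hdisc c k (ray z m t) -> D (ray z m t)).
    rewrite near_withinE.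
    have nUD : \forall w \near z, U w /\ (hdisc c k w -> D w).
      by apply: filterS2 (open_nbhs_nbhs (conj oU Uz)) nD => w.
    have H : nbhs (0 : R) (fun t => U (ray z m t) /\ (hdisc c k (ray z m t) -> D (ray z m t))).
      by apply: (@ray_continuous z m 0 (fun w => U w /\ (hdisc c k w -> D w))); rewrite ray0.
    by apply: filterS H.
  apply: filterS2 nd nU => t dt [Ut hD].
  by apply: le_trans phz; apply/ltW/Dphi => //; exact: hD.
move: (gphi _ Uz) key; move: (pdx phi z) (pdy phi z) => a b gab key.
have perp : - n.2 * a + n.1 * b = 0.
  apply: contrapT => /eqP nz.
  pose q := - n.2 * a + n.1 * b; pose s := n.1 * a + n.2 * b.
  (* With a nonzero tangential component [q], this direction enters the disc and yet the linear form
     takes the value 1 on it. *)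
  have := key (n.1 - (1 - s) / q * n.2, n.2 + (1 - s) / q * n.1).
  rewrite /= (_ : (n.1 - (1 - s) / q * n.2) * n.1 + (n.2 + (1 - s) / q * n.1) * n.2 =
    n.1 ^+ 2 + n.2 ^+ 2); last ring.
  rewrite (_ : (n.1 - (1 - s) / q * n.2) * a + (n.2 + (1 - s) / q * n.1) * b =
    s + (1 - s) / q * q); last by rewrite /s /q; ring.
  by rewrite divfK// => /(_ n2); lra.
pose s := n.1 * a + n.2 * b.
have ea : a * (n.1 ^+ 2 + n.2 ^+ 2) = s * n.1 - n.2 * (- n.2 * a + n.1 * b) by rewrite /s; ring.
have eb : b * (n.1 ^+ 2 + n.2 ^+ 2) = s * n.2 + n.1 * (- n.2 * a + n.1 * b) by rewrite /s; ring.
rewrite perp !mulr0 ?mul0r ?subr0 ?addr0 in ea eb.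
have s0 : s <= 0 by apply: key; rewrite -!expr2.
have sn : s != 0.
  apply: contraNneq gab => s00.
  have N0 : n.1 ^+ 2 + n.2 ^+ 2 != 0 by rewrite gt_eqF.
  have -> : a = 0 by apply: (mulIf N0); rewrite ea s00 !mul0r.
  by have -> : b = 0 by apply: (mulIf N0); rewrite eb s00 !mul0r.
exists (- s / (n.1 ^+ 2 + n.2 ^+ 2)).
  by rewrite divr_gt0// oppr_gt0 lt_neqAle sn.
have N0 : n.1 ^+ 2 + n.2 ^+ 2 != 0 by rewrite gt_eqF.
split; apply: (mulIf N0); [rewrite ea|rewrite eb]; field; by rewrite N0.
Qed.

End boundary_slope.

(** * Contact of the sliding disc with the boundary of the domain *)

Section tangency.
Context {R : realType}.
Implicit Types (z p c : R * R) (u v : R * R -> R).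

Lemma affine_partials (a b c : R) :
  pdx (fun y : R * R => a + b * y.1 + c * y.2) = (fun=> b) /\
  pdy (fun y : R * R => a + b * y.1 + c * y.2) = (fun=> c).
Proof. by split; apply/funext => z; have [] := D2_affine a b c z. Qed.

Lemma disc_poly_partials p (k : R) :
  pdx (disc_poly p k) = (fun w => - 2 * p.1 + 2 * w.1 + 0 * w.2) /\
  pdy (disc_poly p k) = (fun w => - 2 * (p.2 * k) + 0 * w.1 + 2 * w.2).
Proof.
have D x d : is_derive x d (disc_poly p k)
    (2 * (x.1 - p.1) * d.1 + 2 * (x.2 - p.2 * k) * d.2).
  have h1 := is_derive_add (is_derive_fst x d) (is_derive_const (- p.1) x d).
  have h2 := is_derive_add (is_derive_snd x d) (is_derive_const (- (p.2 * k)) x d).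
  apply: is_derive_eq (is_derive_add (is_derive_add (is_derive_sqr h1)
    (is_derive_sqr h2)) (is_derive_const (- (p.2 ^+ 2 * (k ^+ 2 - 1))) x d)) _; ring.
by split; apply/funext => w; rewrite /pdx /pdy (@derive_val _ _ _ _ _ _ _ (D w _))/=; ring.
Qed.

(** The Euclidean centre is removed because the gradient of [disc_poly] vanishes there. *)
Lemma disc_local_defining p (k : R) y : H2 p -> 1 < k -> H2 y -> hcosh p y = k ->
  local_defining (hdisc p k) y (@H2 R `&` ~` [set (p.1, p.2 * k)]) (disc_poly p k).
Proof.
move=> p0 k1 y0 yk; have [ex ey] := disc_poly_partials p k.
have p0' : 0 < p.2 := p0.
split; [|split; [|split; [|split; [|split]]]].
- apply: openI; first exact: open_H2.
  by apply: closed_openC; apply: accessible_closed_set1; apply: hausdorff_accessible; exact: norm_hausdorff.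
- split => //= E; have := hcosh_disc_poly0 p0 y0 yk; rewrite E /disc_poly/= !subrr expr0n/= !add0r.
  move/eqP; rewrite oppr_eq0 mulf_eq0 !expf_eq0 /= gt_eqF//= subr_eq0 gt_eqF//.
  by rewrite exprn_egt1.
- by move=> w [].
- move=> w _.
  have [exx exy] := affine_partials (- 2 * p.1) 2 0.
  have [eyx eyy] := affine_partials (- 2 * (p.2 * k)) 0 2.
  rewrite ex ey exx exy eyx eyy.
  by split; [rewrite /disc_poly; dif|split; [dif|split; [dif|]]]; do !split; exact: cvg_cst.
- move=> w [_ wn]; rewrite ex ey; apply/eqP => -[e1 e2]; apply: wn => /=.
  by rewrite (surjective_pairing w); congr pair; lra.
- move=> w [w0 _]; split; first by move=> [_]; rewrite hcosh_disc_poly.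
  by move=> h; split => //; rewrite hcosh_disc_poly.
Qed.

Lemma recentreE p c z : recentre p c z =
  (p.1 + p.2 / c.2 * (z.1 - c.1), p.2 / c.2 * z.2).
Proof. by rewrite /recentre /haff; congr pair; ring. Qed.

Lemma recentre_hcosh p c z : H2 p -> H2 c -> H2 z ->
  hcosh p (recentre p c z) = hcosh c z.
Proof.
move=> p0 c0 z0; have [_ h _ _] := recentre_isometry p0 c0.
by rewrite -{1}(recentre_centre p c0) h.
Qed.

Lemma recentre_H2 p c z : H2 p -> H2 c -> H2 z -> H2 (recentre p c z).
Proof. by move=> p0 c0; have [h _ _ _] := recentre_isometry p0 c0; exact: h. Qed.

(* The disc being inside [Om] near the contact point, both boundaries have the
   same normal there, so that [u] and [v] have the same slope along it. *)
Lemma no_tangency (Om : set (R * R)) u v (alpha kap k : R) p c z :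
  overdetermined Om u alpha -> C2_boundary Om ->
  overdetermined (hdisc p k) v alpha -> H2 p -> H2 c -> 1 < k -> 1 < kap ->
  alpha < 0 -> hbdry Om z -> hcosh c z = k ->
  ~ (\forall w \near z, hdisc c k w -> Om w /\ kap * v (recentre p c w) <= u w).
Proof.
move=> oOm bOm ov p0 c0 k1 kap1 a0 bz zk nr.
have [p0' c0'] : 0 < p.2 /\ 0 < c.2 by [].
have z0 : H2 z by case: bz. have z0' : 0 < z.2 := z0.
have nOm : ~ Om z by case: bz => -[].
have [U [phi ld]] := bOm _ bz.
have nD : \forall w \near z, hdisc c k w -> Om w by apply: filterS nr => w h /h[].
have [k0 k00 [ex ey]] := disc_tangent_normal c0 z0 zk k1 nD nOm ld.
pose n := inward c k z.
have n2 : 0 < n.1 ^+ 2 + n.2 ^+ 2.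
  by rewrite inward_norm// mulr_gt0 ?exprn_gt0// subr_gt0 exprn_egt1.
have nd : \forall t \near 0^'+, hdisc c k (ray z n t).
  by apply: ray_hdisc => //; rewrite -!expr2.
have nrt : \forall t \near 0^'+, hdisc c k (ray z n t) ->
    Om (ray z n t) /\ kap * v (recentre p c (ray z n t)) <= u (ray z n t).
  rewrite near_withinE.
  have H : nbhs (0 : R) (fun t => hdisc c k (ray z n t) ->
    Om (ray z n t) /\ kap * v (recentre p c (ray z n t)) <= u (ray z n t)).
    by apply: (@ray_continuous _ z n 0 (fun w => hdisc c k w ->
      Om w /\ kap * v (recentre p c w) <= u w)); rewrite ray0.
  by apply: filterS H => t h _; exact: h.
have nOmt : \forall t \near 0^'+, Om (ray z n t).
  by apply: filterS2 nd nrt => t h /(_ h)[].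
pose mu := p.2 / c.2; have mu0 : 0 < mu by rewrite divr_gt0.
pose y := recentre p c z.
have y0 : H2 y by exact: recentre_H2.
have yk : hcosh p y = k by rewrite recentre_hcosh.
have ny : inward p k y = (mu * n.1, mu * n.2).
  rewrite /inward /y recentreE /n /inward /mu/=; congr pair; first ring.
  by field; rewrite gt_eqF.
have rayE t : ray y (inward p k y) t = recentre p c (ray z n t).
  by rewrite ny /ray /y !recentreE /mu/=; congr pair; ring.
have by_ : hbdry (hdisc p k) y.
  split => //; split; first by apply: hdisc_closure => //; split => //; rewrite yk.
  by move=> [_]; rewrite yk ltxx.
have ldv := disc_local_defining p0 k1 y0 yk; have [px py] := disc_poly_partials p k.
have m2 : 0 < (inward p k y).1 ^+ 2 + (inward p k y).2 ^+ 2.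
  by rewrite inward_norm// mulr_gt0 ?exprn_gt0// subr_gt0 exprn_egt1.
have ndv : \forall t \near 0^'+, hdisc p k (ray y (inward p k y) t).
  by apply: ray_hdisc => //; rewrite -!expr2.
pose N := Num.sqrt (n.1 ^+ 2 + n.2 ^+ 2); have N0 : 0 < N by rewrite sqrtr_gt0.
pose L := - alpha * N / z.2; have L0 : 0 < L by rewrite divr_gt0// mulr_gt0// oppr_gt0.
(* Chosen so that [e * (kap + 1)] is half of [(kap - 1) * L]; then kappa (L - e) > L + e. *)
pose e := (kap - 1) * L / (2 * (kap + 1)).
have km : 0 < kap - 1 by rewrite subr_gt0.
have kp : 0 < kap + 1 by rewrite addr_gt0// (lt_trans ltr01).
have e0 : 0 < e by rewrite /e divr_gt0// mulr_gt0.
have su := normal_slope oOm bz ld k00 n2 ex ey nOmt e0.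
have px' : pdx (disc_poly p k) y = - (2 * (inward p k y).1) by rewrite px /inward/=; ring.
have py' : pdy (disc_poly p k) y = - (2 * (inward p k y).2) by rewrite py /inward/=; ring.
have sv := normal_slope ov by_ ldv (ltr0n _ 2) m2 px' py' ndv e0.
(* The similarity [recentre] multiplies the normal and the height by the same [mu], so the slope is
   unchanged. *)
have EL : - alpha * Num.sqrt ((inward p k y).1 ^+ 2 + (inward p k y).2 ^+ 2) / y.2 = L.
  have y2E : y.2 = mu * z.2 by rewrite /y recentreE.
  rewrite ny y2E /=.
  have -> : (mu * n.1) ^+ 2 + (mu * n.2) ^+ 2 = mu ^+ 2 * (n.1 ^+ 2 + n.2 ^+ 2) by ring.
  rewrite sqrtrM ?sqr_ge0// sqrtr_sqr (gtr0_norm mu0) -/N /L -/mu.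
  by field; rewrite !gt_eqF.
rewrite EL in sv; rewrite -/N -/L in su.
have H : \forall t \near (0 : R)^'+, False.
  near=> t; have t0 : 0 < t by near: t; exact: nbhs_right_gt.
  have dt : hdisc c k (ray z n t) by near: t.
  have [_ ht] : Om (ray z n t) /\ kap * v (recentre p c (ray z n t)) <= u (ray z n t).
    by move: dt; near: t.
  have : `|u (ray z n t) - L * t| <= e * t by near: t.
  have : `|v (ray y (inward p k y) t) - L * t| <= e * t by near: t.
  rewrite rayE !ler_norml => /andP[+ _] /andP[_ +]; move: ht.
  move: (v _) (u _) => a b h1 h2 h3.
  have h4 : kap * (L * t - e * t) <= kap * a by rewrite ler_pM2l; lra.
  have h5 : (kap - 1) * L <= e * (kap + 1).
    by rewrite -(ler_pM2r t0); nra.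
  have E : e * (kap + 1) = (kap - 1) * L / 2 by rewrite /e; field; rewrite gt_eqF.
  have : 0 < (kap - 1) * L by rewrite mulr_gt0// subr_gt0.
  by rewrite E in h5; lra.
by have [] := @filter_ex _ _ (at_right_proper_filter (0 : R)) _ H.
Unshelve. all: by end_near. Qed.

End tangency.

(** * Sliding the disc: openness, closedness and the final contradiction *)

Section sliding.
Context {R : realType}.

Let sub_eigen (l kp a b c d : R) : a + l * c <= 0 -> b + l * d = 0 ->
  1 * a + - kp * b + l * (1 * c + - kp * d) <= 0.
Proof.
move=> h1 h2; have -> : 1 * a + - kp * b + l * (1 * c + - kp * d) =
  a + l * c - kp * (b + l * d) by ring.
by rewrite h2 mulr0 subr0.
Qed.

Let neg_eigen (l a b : R) : a + l * b = 0 ->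
  - 1 * a + 0 * a + l * (- 1 * b + 0 * b) <= 0.
Proof.
move=> h; have -> : - 1 * a + 0 * a + l * (- 1 * b + 0 * b) = - (a + l * b) by ring.
by rewrite h oppr0.
Qed.

Variables (Om A : set (R * R)) (u v : R * R -> R) (lam alpha k kap : R) (p : R * R).
Hypotheses (l0 : 0 <= lam) (a0 : alpha < 0) (k1 : 1 < k) (kap1 : 1 < kap) (p0 : H2 p).
Hypotheses (oOm : open Om) (ou : overdetermined Om u alpha) (bOm : C2_boundary Om).
Hypothesis hu : forall z, Om z -> [/\ D2 u z, hlap u z + lam * u z <= 0 & 0 < u z].
Hypotheses (ev : ball_eigen lam p k v) (ov : overdetermined (hdisc p k) v alpha).
Hypothesis oA : open A.
Implicit Types (z c : R * R) (q : (R * R) * (R * R)).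

(** A condition on the pair of a point and a centre, so that a neighbourhood of the pair lets the
    disc move as well. *)
Definition above q := hdisc q.2 k q.1 -> Om q.1 /\ kap * v (recentre p q.2 q.1) < u q.1.

(** All that the sliding has to know about the separating set: the disc meets the frontier of [A]
    only where the strict comparison holds robustly. *)
Definition admissible c := H2 c /\ forall z, hdiscbar c k z -> closure A z ->
  A z \/ \forall q \near (z, c), above q.

(** Vacuous when [A] misses the disc, which starts the sliding. The inequality is weak in order to
    pass to limits of centres. *)
Definition good c := forall z, A z -> hdisc c k z ->
  Om z /\ kap * v (recentre p c z) <= u z.

Let OmH z : Om z -> H2 z. Proof. by case: ou => h _ _ _ _; exact: h. Qed.

Let recentre_cont z c : H2 c -> {for (z, c), continuous (fun q => recentre p q.2 q.1)}.
Proof.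
move=> c0; have c0' : c.2 != 0 by rewrite gt_eqF.
have -> : (fun q : (R * R) * (R * R) => recentre p q.2 q.1) =
  fun q => (p.1 + p.2 / q.2.2 * (q.1.1 - q.2.1), p.2 / q.2.2 * q.1.2).
  by apply/funext => q; exact: recentreE.
by cont.
Qed.

Let near_fst z c (P : set (R * R)) : nbhs z P -> \forall q \near (z, c), P q.1.
Proof. by move=> nP; apply: (@cvg_fst _ _ (nbhs z) (nbhs c)). Qed.

Let near_snd z c (P : set (R * R)) : nbhs c P -> \forall q \near (z, c), P q.2.
Proof. by move=> nP; apply: (@cvg_snd _ _ (nbhs z) (nbhs c)). Qed.

Let hcosh_cont z c : H2 z -> H2 c -> {for (z, c), continuous (fun q => hcosh q.2 q.1)}.
Proof. move=> z0 c0; apply: (@hcosh_continuous _ _ snd fst (z, c)).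
- exact: cvg_snd.
- exact: cvg_fst.
- exact: c0.
- exact: z0.
 Qed.

Let recentre_disc c z : H2 c -> hdisc c k z -> hdisc p k (recentre p c z).
Proof.
by move=> c0 [z0 zk]; split; [exact: recentre_H2|rewrite recentre_hcosh].
Qed.

(** [no_tangency] excludes the boundary of [Om], so that [u z] is positive while the copy of [v]
    vanishes on the circle; nearby, kappa times the copy is below [u z / 2], and [u] above it. *)
Lemma above_boundary c z : H2 c -> good c -> A z -> H2 z -> hcosh c z = k ->
  \forall q \near (z, c), above q.
Proof.
move=> c0 gc Az z0 zk.
have nA : \forall w \near z, hdisc c k w -> Om w /\ kap * v (recentre p c w) <= u w.
  by apply: filterS (open_nbhs_nbhs (conj oA Az)) => w Aw dw; exact: gc.
have [Omz|nOm] := pselect (Om z); last first.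
  exfalso; apply: (no_tangency ou bOm ov p0 c0 k1 kap1 a0 _ zk nA).
  split => //; split => // B nB.
  have zc : closure (hdisc c k) z by apply: hdisc_closure => //; split => //; rewrite zk.
  have [w [dw [Bw h]]] := zc _ (filterI nB nA).
  by exists w; split => //; have [] := h dw.
have [Du _ u0] := hu Omz.
have [cv _ bv] := ev.
pose y := recentre p c z.
have y0 : H2 y by exact: recentre_H2.
have yk : hcosh p y = k by rewrite recentre_hcosh.
have ub : 0 < u z / (2 * kap) by rewrite divr_gt0// mulr_gt0// (lt_trans ltr01).
have kap0 : 0 < kap by rewrite (lt_trans ltr01).
have n1 : \forall w \near y, hdiscbar p k w -> v w < u z / (2 * kap).
  have yb : hdiscbar p k y by split => //; rewrite yk.
  have := (subspace_continuousP _ v).1 cv y yb; rewrite bv// => h.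
  exact: (h [set r | r < u z / (2 * kap)] (open_nbhs_nbhs (conj (@open_lt R _) ub))).
have n2 : \forall q \near (z, c), hdiscbar p k (recentre p q.2 q.1) ->
    v (recentre p q.2 q.1) < u z / (2 * kap) := recentre_cont c0 n1.
have n3 : \forall w \near z, Om w := open_nbhs_nbhs (conj oOm Omz).
have n4 : \forall w \near z, u z / 2 < u w.
  apply: (@cont_lt _ _ (fun=> u z / 2) u); [exact: cont_cst|exact: D2_continuous|].
  by rewrite ltr_pdivrMr// ltr_pMr// ltr1n.
have n5 : \forall w \near c, H2 w := open_nbhs_nbhs (conj (@open_H2 R) c0).
have n34 := near_fst c (filterI n3 n4).
have n6 := near_snd z n5.
near=> q => dq.
have h2 : hdiscbar p k (recentre p q.2 q.1) -> v (recentre p q.2 q.1) < u z / (2 * kap).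
  by near: q; exact: n2.
have [h3 h4] : Om q.1 /\ u z / 2 < u q.1 by near: q; exact: n34.
have h5 : H2 q.2 by near: q; exact: n6.
split => //.
have [dH /ltW dk] := recentre_disc h5 dq.
apply: lt_trans h4; rewrite -ltr_pdivlMl//.
by apply: lt_le_trans (h2 (conj dH dk)) _; rewrite invfM mulrA mulrC.
Unshelve. all: by end_near. Qed.

Lemma strict_at c z : admissible c -> good c -> hdiscbar c k z -> closure A z ->
  (A z /\ hdisc c k z) \/ \forall q \near (z, c), above q.
Proof.
move=> [c0 ac] gc zk cz; have [Az|] := ac z zk cz; last by right.
have [z0 zk'] := zk; move: zk'; rewrite le_eqVlt => /orP[/eqP e|lt]; last by left.
by right; exact: above_boundary.
Qed.

(** [superharmonic_pos] wants a compact zero set. Zeros of [F] cannot accumulate on the frontier of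
    [A] nor on the circle, since the inequality is strict near such points. *)
Lemma good_strict c z : admissible c -> good c -> A z -> hdisc c k z ->
  kap * v (recentre p c z) < u z.
Proof.
move=> ac gc Az dz; have c0 : H2 c by case: ac.
have evc := recentre_eigen p0 c0 ev; have [cvc hvc bvc] := evc.
pose F y := 1 * u y + (- kap) * (v \o recentre p c) y.
have FE y : F y = u y - kap * v (recentre p c y) by rewrite /F mul1r mulNr.
pose O := A `&` hdisc c k.
have oO : open O by apply: openI => //; exact: hdisc_open.
have hO y : O y -> [/\ D2 F y, lap F y <= 0 & 0 <= F y].
  move=> [Ay dy]; have [Oy uy] := gc y Ay dy; have [Du lu _] := hu Oy.
  have [Dv lv _] := hvc y dy; have F0 : 0 <= F y by rewrite FE subr_ge0.
  have [DF _] := D2_lin 1 (- kap) Du Dv; split; [exact: DF| |exact: F0].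
  apply: (superharmonic_of_hlap l0 (OmH Oy) F0); rewrite (hlap_lin _ _ Du Dv) /F.
  exact: sub_eigen.
suff : 0 < F z by rewrite FE subr_gt0.
apply: (superharmonic_pos oO hO); last by split.
apply: (subclosed_compact _ (hdiscbar_compact c0 (ltW k1))); last first.
  by move=> y [[_ [y0 /ltW yk]] _]; split.
move=> y cy.
have yk : hdiscbar c k y.
  apply: (hdiscbar_closed c0 (ltW k1)) => B /cy[w [[[_ [w0 /ltW wk]] _] Bw]].
  by exists w; split.
have yA : closure A y by move=> B /cy[w [[[Aw _] _] Bw]]; exists w; split.
have [[Ay dy]|ab] := strict_at ac gc yk yA.
  split; first by split.
  apply: contrapT => /eqP Fy; have [DF _ _] := hO y (conj Ay dy).
  have nF : \forall w \near y, F w != 0.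
    exact: (D2_continuous DF (open_nbhs_nbhs (conj (@open_neq R 0) Fy))).
  by have [w [[_ Fw]]] := cy _ nF; rewrite Fw eqxx.
exfalso.
have cc : {for y, continuous (fun w => (w, c))} by cont.
have nab : \forall w \near y, above (w, c) := cc _ ab.
have [w [[[_ dw] Fw] aw]] := cy _ nab.
have [_] := aw dw; rewrite -subr_gt0 -FE Fw ltxx.
by [].
Qed.

(** Each point has its own neighbourhood of good centres; a compact box containing all the discs
    with centre near [c] makes one neighbourhood serve for all points. *)
Lemma good_near c : admissible c -> good c -> \forall c' \near c, good c'.
Proof.
move=> ac gc; have c0 : H2 c by case: ac. have c0' : 0 < c.2 := c0.
have kap0 : 0 < kap by rewrite (lt_trans ltr01).
have k0 : 0 < k by rewrite (lt_trans ltr01).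
(* The bounds of [hdiscbar_box] for centres at height between [c.2 / 2] and [2 * c.2] and at
   horizontal distance less than 1 from [c]. *)
pose M := 1 + 2 * c.2 * (1 + 2 * k).
pose X := `[c.1 - M, c.1 + M]%classic `*` `[c.2 / (4 * k), M]%classic : set (R * R).
have XH z : X z -> H2 z.
  move=> [_ /=]; rewrite in_itv/= => /andP[h _]; apply: lt_le_trans h.
  by rewrite divr_gt0// mulr_gt0.
have cX : compact X by apply: compact_setX; exact: segment_compact.
have nX : \forall c' \near c, H2 c' /\ hdisc c' k `<=` X.
  have N (f g : R * R -> R) : {for c, continuous f} -> {for c, continuous g} ->
    f c < g c -> \forall x \near c, f x < g x by exact: cont_lt.
  have b1 : \forall x \near c, x.2 < 2 * c.2.
    by apply: (N snd (fun=> 2 * c.2)); [cont|cont|lra].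
  have b2 : \forall x \near c, c.2 / 2 < x.2.
    by apply: (N (fun=> c.2 / 2) snd); [cont|cont|lra].
  have b3 : \forall x \near c, c.1 - 1 < x.1.
    by apply: (N (fun=> c.1 - 1) fst); [cont|cont|lra].
  have b4 : \forall x \near c, x.1 < c.1 + 1.
    by apply: (N fst (fun=> c.1 + 1)); [cont|cont|lra].
  apply: filterS2 (filterI b1 b2) (filterI b3 b4) => x [h1 h2] [h3 h4].
  have x0 : H2 x by rewrite /H2/=; lra.
  split => // z [z0 /ltW zk].
  have [/boxP[e1 e2 e3 e4] e5] := hdiscbar_box x0 (ltW k1) (conj z0 zk).
  have kx : 2 * k * x.2 <= 2 * k * (2 * c.2) by rewrite ler_pM2l ?mulr_gt0// ltW.
  have kc := mulr_gt0 k0 c0'.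
  split; rewrite /= in_itv/= /M; apply/andP; split; try (lra).
  rewrite ler_pdivrMr ?mulr_gt0//; lra.
have cov : forall z, X z -> \forall z' \near z & c' \near c,
    A z' -> hdisc c' k z' -> Om z' /\ kap * v (recentre p c' z') <= u z'.
  move=> z Xz; have z0 := XH _ Xz.
  suff : \forall q \near (z, c), A q.1 -> above q.
    move=> H; apply: (@filterS _ (filter_prod (nbhs z) (nbhs c)) _ _ _ _ H).
    by move=> q h Aq dq; have [? /ltW] := h Aq dq.
  have [zk|zk] := leP (hcosh c z) k; last first.
    have : \forall q \near (z, c), k < hcosh q.2 q.1.
      apply: (@cont_lt _ _ (fun=> k) (fun q => hcosh q.2 q.1)) => //; first exact: cont_cst.
      exact: hcosh_cont.
    by apply: filterS => q h _ [_]; rewrite ltNge (ltW h).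
  have [cz|ncz] := pselect (closure A z); last first.
    have nA : \forall w \near z, ~ A w.
      apply: contrapT => h; apply: ncz => B nB; apply: contrapT => h'.
      by apply: h; apply: filterS nB => w Bw Aw; apply: h'; exists w.
    by apply: filterS (near_fst c nA) => q h /h.
  have [[Az dz]|ab] := strict_at ac gc (conj z0 zk) cz; last by apply: filterS ab => q + _; apply.
  have [Omz _] := gc z Az dz; have st := good_strict ac gc Az dz.
  have [Du _ _] := hu Omz; have [_ hv _] := ev.
  have [Dv _ _] := hv _ (recentre_disc c0 dz).
  have n1 : \forall q \near (z, c), kap * v (recentre p q.2 q.1) < u q.1.
    apply: (@cont_lt _ _ (fun q => kap * v (recentre p q.2 q.1)) (fun q => u q.1)) => //.
      apply: (@cont_mul _ _ (fun=> kap)); first exact: cont_cst.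
      apply: (@cont_comp _ _ _ (fun q => recentre p q.2 q.1) v); first exact: recentre_cont.
      exact: D2_continuous.
    apply: (@cont_comp _ _ _ fst u); first exact: cvg_fst.
    exact: D2_continuous.
  have n2 := near_fst c (open_nbhs_nbhs (conj oOm Omz)).
  apply: (@filterS2 _ (filter_prod (nbhs z) (nbhs c)) _ _ _ _ _ n1 n2).
  by move=> q h1 h2 _ _; split.
have H := (compact_near_coveringP X).1 cX _ (nbhs c)
  (fun c' z' => A z' -> hdisc c' k z' -> Om z' /\ kap * v (recentre p c' z') <= u z') _ cov.
apply: (@filterS2 _ (nbhs c) _ _ _ _ _ nX (H _)).
by move=> c' [c'0 dX] h z Az dz; exact: h (dX _ dz) Az dz.
Qed.

(** A point of the open disc about [c] also lies in the discs of nearby good centres, which gives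
    membership in [Om]; the weak inequality passes to the limit. *)
Lemma good_closed c : H2 c -> closure good c -> good c.
Proof.
move=> c0 cg z Az dz; have [z0 zk] := dz.
have cc : {for c, continuous (fun w => (z, w))} by cont.
have nd : \forall w \near c, hdisc w k z.
  have : \forall w \near c, hcosh w z < k.
    apply: (@cont_lt _ _ (fun w => hcosh w z) (fun=> k)) => //; last exact: cont_cst.
    by apply: hcosh_continuous => //; cont.
  by apply: filterS => w; split.
have Omz : Om z by have [w [gw dw]] := cg _ nd; have [] := gw z Az dw.
split => //; rewrite leNgt; apply/negP => lt.
have [_ hv _] := ev; have [Dv _ _] := hv _ (recentre_disc c0 dz).
have nl : \forall w \near c, u z < kap * v (recentre p w z).
  apply: (@cont_lt _ _ (fun=> u z) (fun w => kap * v (recentre p w z))) => //.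
    exact: cont_cst.
  apply: (@cont_mul _ _ (fun=> kap)); first exact: cont_cst.
  apply: (@cont_comp _ _ _ (fun w => recentre p w z) v); last exact: D2_continuous.
  exact: (@cont_comp _ _ _ (fun w => (z, w)) (fun q => recentre p q.2 q.1) _ cc (recentre_cont c0)).
have [w [gw [dw lw]]] := cg _ (filterI nd nl).
by have [_] := gw z Az dw; rewrite leNgt lw.
Qed.

(** On the whole closed disc [u] is a positive supersolution, so [eigen_comparison] makes the
    negative of the copy of [v] nonnegative. A point of the circle is seen to be in [Om] by shifting
    the centre slightly towards it, which keeps the centre good. *)
Lemma good_absurd c : admissible c -> good c -> ~ (hdiscbar c k `<=` A).
Proof.
move=> ac gc dA; have c0 : H2 c by case: ac.
have dOm z : hdiscbar c k z -> Om z.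
  move=> zk; have Az := dA _ zk; have [z0 zk'] := zk.
  move: (zk'); rewrite le_eqVlt => /orP[/eqP e|lt]; last by have [] := gc z Az (conj z0 lt).
  have cz : c <> z by move=> E; move: e k1; rewrite E hcosh_refl => <-; rewrite ltxx.
  have H : \forall t \near 0^'+, good (toward c z t) /\ hdisc (toward c z t) k z.
    near=> t; have t0 : 0 < t by near: t; exact: nbhs_right_gt.
    have t1 : t <= 1 by near: t; exact: nbhs_right_le.
    split; first by near: t; apply: near_toward; exact: good_near.
    split => //; rewrite hcosh_sym -e hcosh_sym [X in _ < X]hcosh_sym.
    by rewrite hcosh_sym; apply: hcosh_toward => //; rewrite t0.
  have [t [gt dt]] := @filter_ex _ _ (at_right_proper_filter (0 : R)) _ H.
  by have [] := gt z Az dt.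
have [cvc hvc bvc] := recentre_eigen p0 c0 ev.
have cc : hdisc c k c by split => //; rewrite hcosh_refl.
have [_ _ vpos] := hvc c cc.
suff : 0 <= - 1 * (v \o recentre p c) c + 0 * (v \o recentre p c) c.
  by rewrite mul0r addr0 mulN1r oppr_ge0 leNgt vpos.
apply: (@eigen_comparison _ (hdisc c k) (hdiscbar c k)
  (fun z => - 1 * (v \o recentre p c) z + 0 * (v \o recentre p c) z) u lam).
- exact: hdisc_open.
- by move=> z [].
- exact: hdiscbar_compact c0 (ltW k1).
- by move=> z [z0 /ltW zk]; split.
- exact: l0.
- apply/subspace_continuousP => z zk; have h := (subspace_continuousP _ (v \o recentre p c)).1 cvc z zk.
  exact: (cvgD (cvgM (cvg_cst (- 1 : R)) h) (cvgM (cvg_cst (0 : R)) h)).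
- apply: continuous_in_subspaceT => z; rewrite inE => /dOm/hu[Du _ _].
  exact: D2_continuous.
- by move=> z /dOm/hu[].
- move=> z [z0 zk] nz; have e : hcosh c z = k.
    apply/eqP; rewrite eq_le zk leNgt; apply/negP => lt; exact: nz (conj z0 lt).
  by rewrite (bvc z z0 e) !mulr0 addr0.
- move=> z dz; have [Dv Ev _] := hvc z dz.
  split; first by have [] := D2_lin (- 1) 0 Dv Dv.
  by rewrite (hlap_lin _ _ Dv Dv); exact: neg_eigen.
- move=> z [z0 /ltW zk]; have [Du lu _] := hu (dOm z (conj z0 zk)).
  by split; [exact: Du|exact: lu].
- exact: cc.
Unshelve. all: by end_near. Qed.

Lemma sliding_absurd (gam : R -> R * R) :
  (forall t, 0 < t -> admissible (gam t)) ->
  (forall t, 0 < t -> {for t, continuous gam}) ->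
  (exists2 t : R, 0 < t & forall z, A z -> ~ hdisc (gam t) k z) ->
  ~ (exists2 t : R, 0 < t & hdiscbar (gam t) k `<=` A).
Proof.
move=> adm cg [t1 t10 empty] [t2 t20 full].
pose T := [set t : R | 0 < t]; pose B := [set t | 0 < t /\ good (gam t)].
have iT : connected T.
  by apply/connected_intervalP => a b ha hb c /andP[ac _]; exact: lt_le_trans ac.
suff BT : B = T.
  have [_ g2] : B t2 by rewrite BT.
  exact: (good_absurd (adm _ t20) g2 full).
apply: iT.
- by exists t1; split => // z Az /(empty _ Az).
- exists B; last by apply/seteqP; split => t [] //.
  rewrite openE => t [t0 gt].
  have n1 : \forall s \near t, 0 < s by exact: (open_nbhs_nbhs (conj (@open_gt R 0) t0)).
  have n2 := cg t t0 _ (good_near (adm _ t0) gt).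
  by apply: filterS2 n1 n2 => s.
- exists (closure B); first exact: closed_closure.
  apply/seteqP; split => t [t0 h]; first by split => //; apply: subset_closure.
  split => //; apply: good_closed; first by case: (adm _ t0).
  by move=> C nC; have [s [[s0 gs] Cs]] := h _ (cg t t0 _ nC); exists (gam s).
Qed.

End sliding.

(** * Connected components, and smallness of the eigenfunction near the circle *)

Section topology.
Context {R : realType}.
Implicit Types (x z : R * R) (S W : set (R * R)).

Lemma box_connected z (r : R) : 0 < r -> connected (box z r).
Proof.
move=> r0.
pose seg (y : R * R) := (fun t : R => (z.1 + t * (y.1 - z.1), z.2 + t * (y.2 - z.2)))
  @` `[0, 1]%classic.
have -> : box z r = \bigcup_(y in box z r) seg y.
  apply/seteqP; split => [y By|w [y /boxP[b1 b2 b3 b4] [t]]].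
    exists y => //; exists 1; first by rewrite /= in_itv/= ler01 lexx.
    by rewrite [RHS]surjective_pairing; congr pair; ring.
  rewrite /= in_itv/= => /andP[t0 t1] <-; apply/boxP => /=.
  by split; nra.
apply: bigcup_connected.
  exists z => y _; exists 0; first by rewrite /= in_itv/= ler01 lexx.
  by rewrite !mul0r !addr0 -surjective_pairing.
move=> y _; apply: connected_continuous_connected.
  by apply/connected_intervalP; exact: interval_is_interval.
by apply/continuous_subspaceT => t; have : {for t, continuous
  (fun t : R => (z.1 + t * (y.1 - z.1), z.2 + t * (y.2 - z.2)))} by cont.
Qed.

Lemma component_open S x : open S -> open (connected_component S x).
Proof.
move=> oS; rewrite openE => z cz.
have Sz := connected_component_sub cz.
have [r r0 hr] := nbhs_box (open_nbhs_nbhs (conj oS Sz)).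
have Bz : box z r z by apply/boxP; split; lra.
have nz : \forall t \near z, box z r t by apply: box_nbhs; lra.
apply: filterS nz => t Bt; apply: connected_component_trans cz _.
by apply: (connected_component_max Bz hr _ Bt); exact: box_connected.
Qed.

Lemma connected_between (T : topologicalType) (W E : set T) : connected W -> W `<=` E ->
  E `<=` closure W -> connected E.
Proof.
move=> cW WE Ecl B [b Bb] [C oC BC] [D cD BD].
have WB : W `&` C = W.
  apply: cW.
  - have [Eb Cb] : (E `&` C) b by rewrite -BC.
    by have [w [Ww Cw]] := Ecl _ Eb _ (open_nbhs_nbhs (conj oC Cb)); exists w.
  - by exists C.
  - exists D => //; apply/seteqP; split => w [Ww h]; split => //.
      by have [] : (E `&` D) w by rewrite -BD BC; split => //; exact: WE.
    by have [] : (E `&` C) w by rewrite -BC BD; split => //; exact: WE.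
rewrite BD; apply/seteqP; split => [e []//|e Ee]; split => //.
apply: cD => N nN; have [w [Ww Nw]] := Ecl _ Ee _ nN; exists w; split => //.
have : (W `&` C) w by rewrite WB.
by move=> [_ Cw]; have [] : (E `&` D) w by rewrite -BD BC; split => //; exact: WE.
Qed.

Lemma compact_nonneg (T : topologicalType) (K : set T) (F : T -> R) : compact K ->
  {within K, continuous F} -> compact [set z | K z /\ 0 <= F z].
Proof.
move=> cK cF.
have /closed_subspaceP[V cV VE] : closed ([set z | 0 <= F z] : set (subspace K)).
  exact: closed_nonneg.
suff -> : [set z | K z /\ 0 <= F z] = K `&` V by exact: compact_closedI.
by rewrite setIC VE; apply/seteqP; split => z [].
Qed.

(** The points with [v >= eps] form a compact set that avoids the circle, so their distance to [p]
    has a maximum below the radius. *)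
Lemma ball_eigen_small (lam k eps : R) p v : H2 p -> 1 < k -> 0 < eps ->
  ball_eigen lam p k v ->
  exists2 k' : R, 1 <= k' < k & forall w, hdiscbar p k w -> k' < hcosh p w -> v w < eps.
Proof.
move=> p0 k1 e0 [cv hv bv].
pose P := [set w | hdiscbar p k w /\ 0 <= v w - eps].
have cP : compact P.
  apply: compact_nonneg; first exact: hdiscbar_compact p0 (ltW k1).
  apply/subspace_continuousP => z zk.
  have h := (subspace_continuousP _ v).1 cv z zk.
  exact: (cvgB h (cvg_cst eps)).
have [P0|nP] := pselect (P !=set0); last first.
  (* No point has [v >= eps]: any threshold would do. *)
  exists 1; first by rewrite lexx.
  by move=> w wk _; rewrite ltNge; apply/negP => h; apply: nP; exists w; split; rewrite // subr_ge0.
have [|w wP wmax] := @compact_EVT_max _ R (hcosh p) P P0 cP.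
  apply: continuous_in_subspaceT => w; rewrite inE => -[[w0 _] _].
  by apply: (@hcosh_continuous _ _ (fun=> p) id w); [exact: cont_cst|exact: cont_id| |].
have [[w0 wk] vw] : P w by rewrite inE in wP.
exists (hcosh p w).
  rewrite hcosh_ge1//= lt_neqAle wk andbT; apply/eqP => e.
  by move: vw; rewrite (bv w w0 e) sub0r oppr_ge0 leNgt e0.
move=> y yk lt; rewrite ltNge; apply/negP => h.
have : hcosh p y <= hcosh p w by apply: wmax; rewrite inE; split; rewrite // subr_ge0.
by rewrite leNgt lt.
Qed.

End topology.

(** * Two points of the closure of a superlevel component *)

Section width.
Context {R : realType}.
Variables (Om : set (R * R)) (u v : R * R -> R) (lam alpha k : R) (p : R * R).
Hypotheses (l0 : 0 <= lam) (a0 : alpha < 0) (k1 : 1 < k) (p0 : H2 p).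
Hypotheses (oOm : open Om) (ou : overdetermined Om u alpha) (bOm : C2_boundary Om).
Hypothesis hu : forall z, Om z -> [/\ D2 u z, hlap u z + lam * u z <= 0 & 0 < u z].
Hypotheses (ev : ball_eigen lam p k v) (ov : overdetermined (hdisc p k) v alpha).
Implicit Types (x y z : R * R) (W : set (R * R)).

Let h0 := v p.

Let h0_gt0 : 0 < h0.
Proof.
have [_ hv _] := ev; have [] // := hv p.
by split; rewrite ?hcosh_refl.
Qed.

Let OmH z : Om z -> H2 z. Proof. by case: ou => h _ _ _ _; exact: h. Qed.

Let u_cont z : Om z -> {for z, continuous u}.
Proof. by move=> /hu[Du _ _]; exact: D2_continuous. Qed.

Let recentre_discbar c z : H2 c -> hdisc c k z -> hdiscbar p k (recentre p c z).
Proof.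
by move=> c0 [z0 /ltW zk]; split; [exact: recentre_H2|rewrite recentre_hcosh].
Qed.

Lemma oriented_width_absurd W x y g (m0 a b : R) : connected W ->
  W `<=` [set z | Om z /\ h0 < u z] -> closure W x -> closure W y ->
  Om x -> Om y -> h0 <= u x -> h0 <= u y -> hisometry g ->
  (forall z, H2 z -> g (g z) = z) -> 0 < b -> 0 <= a ->
  (k ^+ 2 - 1) * b ^+ 2 <= a ^+ 2 -> g x = (m0 - a, b) -> g y = (m0 + a, b) -> False.
Proof.
move=> cW WS clx cly Ox Oy ux uy hg gK b0 a00 kab gx gy.
have h04 : 0 < h0 / 4 by rewrite divr_gt0.
have [k' /andP[k'1 k'k] small] := ball_eigen_small p0 k1 h04 ev.
(* Points far enough from the axis for every disc centred on it to have its copy of [v] below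
   [h0 / 4] around them. Both [x] and [y] qualify, even with [u] equal to [h0] there. *)
pose Pn z := [/\ Om z, h0 / 2 < u z & k' ^+ 2 < 1 + (strip g m0 z).1 ^+ 2].
have Pn_open z : Pn z -> \forall w \near z, Pn w.
  move=> [Oz uz sz].
  have n1 : \forall w \near z, Om w := open_nbhs_nbhs (conj oOm Oz).
  have n2 : \forall w \near z, h0 / 2 < u w.
    by apply: (@cont_lt _ _ (fun=> h0 / 2) u); [exact: cont_cst|exact: u_cont|].
  have n3 : \forall w \near z, k' ^+ 2 < 1 + (strip g m0 w).1 ^+ 2.
    apply: (@cont_lt _ _ (fun=> k' ^+ 2) (fun w => 1 + (strip g m0 w).1 ^+ 2)) => //.
      exact: cont_cst.
    have sc := strip_continuous hg (OmH Oz) (m0 := m0).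
    apply: (@cont_add _ _ (fun=> 1)); first exact: cont_cst.
    by apply: (@cont_sqr _ _ (fun w => (strip g m0 w).1)); exact: cont_fst.
  by near=> w; split; near: w.
have k'2 : k' ^+ 2 < k ^+ 2 by rewrite ltr_pXn2r// nnegrE (le_trans ler01)// ltW.
have abk : k ^+ 2 - 1 <= (a / b) ^+ 2 by rewrite expr_div_n ler_pdivlMr// exprn_gt0.
have half w : h0 <= u w -> h0 / 2 < u w.
  by apply: lt_le_trans; rewrite ltr_pdivrMr// ltr_pMr// ltr1n.
have Pnx : Pn x.
  split => //; first exact: half.
  by rewrite /strip gx/= addrAC subrr add0r mulNr sqrrN; lra.
have Pny : Pn y.
  split => //; first exact: half.
  by rewrite /strip gy/= addrAC subrr add0r; lra.
pose S := [set z | Om z /\ (h0 < u z \/ Pn z)].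
have oS : open S.
  rewrite openE => z [Oz [uz|pz]]; last by apply: filterS (Pn_open _ pz) => w pw; split; [case: pw|right].
  have n1 : \forall w \near z, Om w := open_nbhs_nbhs (conj oOm Oz).
  have n2 : \forall w \near z, h0 < u w.
    by apply: (@cont_lt _ _ (fun=> h0) u); [exact: cont_cst|exact: u_cont|].
  by apply: filterS2 n1 n2 => w ? ?; split => //; left.
(* Adjoining two points of its closure keeps [W] connected, and the enlarged set still lies in the
   open set [S]. *)
pose E := W `|` [set x; y].
have cE : connected E.
  apply: (connected_between cW); first by move=> z; left.
  by move=> z [Wz|[->|->]] //; exact: subset_closure.
have ES : E `<=` S.
  move=> z [/WS[Oz uz]|[->|->]]; [by split => //; left| |]; by split => //; right.
pose U := connected_component S x.
have oU : open U by exact: component_open.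
have cU : connected U by exact: component_connected.
have US : U `<=` S by exact: connected_component_sub.
have UH : U `<=` @H2 R by move=> z /US[/OmH].
have Ex : E x by right; left.
have EU : E `<=` U by exact: connected_component_max.
have Uy : U y by apply: EU; right; right.
have [K [A [[cK KU] [oA _] sep low top]]] :=
  axis_separation hg gK k1 b0 a00 kab oU cU UH (EU _ Ex) Uy gx gy.
(* Off the open set [Pn] the rest of [K] is compact with [u > h0], so that the minimum of [u] there
   leaves room for [kap]. The cap 2 turns [v < h0 / 4] into kappa v < h0 / 2 on [Pn]. *)
have [kap /andP[kap1 kap2] hkap] : exists2 kap : R, 1 < kap <= 2 &
    forall z, K z -> kap * h0 < u z \/ Pn z.
  pose K0 := K `&` ~` [set z | Pn z].
  have cK0 : compact K0.
    apply: compact_closedI => //; apply: open_closedC; rewrite openE => z.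
    exact: Pn_open.
  have K0S z : K0 z -> Om z /\ h0 < u z.
    by move=> [/KU/US[Oz [uz|pz]] nz]; split.
  have [K00|nK0] := pselect (K0 !=set0); last first.
    exists 2; first by rewrite lexx ltr1n.
    by move=> z Kz; right; apply: contrapT => nz; apply: nK0; exists z.
  have [|c cK' cmin] := @compact_EVT_min _ R u K0 K00 cK0.
    by apply: continuous_in_subspaceT => z; rewrite inE => /K0S[Oz _]; exact: u_cont.
  have [_ uc] : Om c /\ h0 < u c by apply: K0S; rewrite inE in cK'.
  pose q := (1 + u c / h0) / 2.
  have q1 : 1 < u c / h0 by rewrite ltr_pdivlMr// mul1r.
  exists (Num.min q 2).
    by rewrite lt_min ltr1n andbT ge_min lexx orbT andbT /q; lra.
  move=> z Kz; have [pz|nz] := pselect (Pn z); [by right|left].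
  have : u c <= u z by apply: cmin; rewrite inE; split.
  apply: lt_le_trans; rewrite -ltr_pdivlMr// gt_min; apply/orP; left; rewrite /q; lra.
have kap0 : 0 < kap by rewrite (lt_trans ltr01).
apply: (sliding_absurd (gam := axis g m0) l0 a0 k1 kap1 p0 oOm ou bOm hu ev ov oA _ _ low top).
- move=> t t0; have c0 := axis_H2 m0 hg t0; split => // z zk cz.
  have [Az|Kz] := sep t z t0 zk cz; [by left|right].
  have Oz : Om z by have [] := US _ (KU _ Kz).
  have n1 : \forall q \near (z, axis g m0 t), Om q.1.
    by apply: (@cvg_fst _ _ (nbhs z) (nbhs (axis g m0 t))); exact: (open_nbhs_nbhs (conj oOm Oz)).
  have n2 : \forall q \near (z, axis g m0 t), H2 q.2.
    by apply: (@cvg_snd _ _ (nbhs z) (nbhs (axis g m0 t))); exact: (open_nbhs_nbhs (conj (@open_H2 R) c0)).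
  have uc : {for (z, axis g m0 t), continuous (fun q : (R * R) * (R * R) => u q.1)}.
    by apply: (@cont_comp _ _ _ fst u); [exact: cvg_fst|exact: u_cont].
  have [uz|[_ uz sz]] := hkap _ Kz.
    have n3 : \forall q \near (z, axis g m0 t), kap * h0 < u q.1.
      by apply: (@cont_lt _ _ (fun=> kap * h0) (fun q => u q.1)); [exact: cont_cst|exact: uc|].
    near=> q => dq.
    have Oq : Om q.1 by near: q; exact: n1.
    have Hq : H2 q.2 by near: q; exact: n2.
    have uq : kap * h0 < u q.1 by near: q; exact: n3.
    split => //; apply: le_lt_trans uq; rewrite ler_pM2l//.
    exact: (ball_eigen_max l0 p0 k1 ev (recentre_discbar Hq dq)).
  have n3 : \forall q \near (z, axis g m0 t), h0 / 2 < u q.1.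
    by apply: (@cont_lt _ _ (fun=> h0 / 2) (fun q => u q.1)); [exact: cont_cst|exact: uc|].
  have n4 : \forall q \near (z, axis g m0 t), k' < hcosh q.2 q.1.
    apply: (@cont_lt _ _ (fun=> k') (fun q => hcosh q.2 q.1)); first exact: cont_cst.
      apply: (@hcosh_continuous _ _ snd fst (z, axis g m0 t)).
      + exact: cvg_snd.
      + exact: cvg_fst.
      + exact: c0.
      + exact: OmH.
    have h := axis_hcosh_ge m0 hg gK t0 (OmH Oz).
    have h1 := hcosh_ge1 c0 (OmH Oz).
    rewrite -(@ltr_pXn2r _ 2%N)//; first exact: lt_le_trans h.
    + by rewrite nnegrE (le_trans ler01).
    + by rewrite nnegrE (le_trans ler01).
  near=> q => dq.
  have Oq : Om q.1 by near: q; exact: n1.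
  have Hq : H2 q.2 by near: q; exact: n2.
  have uq : h0 / 2 < u q.1 by near: q; exact: n3.
  have kq : k' < hcosh q.2 q.1 by near: q; exact: n4.
  split => //; apply: lt_trans uq.
  have rq := recentre_discbar Hq dq.
  have vq : v (recentre p q.2 q.1) < h0 / 4.
    by apply: small => //; rewrite recentre_hcosh//; exact: OmH.
  have vq0 := ball_eigen_ge0 ev rq.
  apply: (@le_lt_trans _ _ (2 * v (recentre p q.2 q.1))); first by rewrite ler_wpM2r.
  by move: vq; move: (v _) => r; lra.
- by move=> t t0; exact: axis_continuous.
Unshelve. all: by end_near. Qed.

Lemma superlevel_width W x y : connected W ->
  W `<=` [set z | Om z /\ h0 < u z] -> closure W x -> closure W y ->
  Om x -> Om y -> h0 <= u x -> h0 <= u y -> hcosh x y < 2 * k ^+ 2 - 1.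
Proof.
move=> cW WS clx cly Ox Oy ux uy; rewrite ltNge; apply/negP => wide.
have [x0 y0] : H2 x /\ H2 y by split; exact: OmH.
have [g [hg gK gxy]] := hnormalize x0 y0.
have [gH gC _ _] := hg.
have b0 : 0 < (g x).2 := gH _ x0.
pose m := ((g x).1 + (g y).1) / 2; pose a := ((g y).1 - (g x).1) / 2.
(* At equal heights b and horizontal distance 2 a, [hcosh] is 1 + 2 (a / b)^2; being at least 2 k^2
   - 1 it gives (a / b)^2 >= k^2 - 1. *)
have ka : (k ^+ 2 - 1) * (g x).2 ^+ 2 <= a ^+ 2.
  move: wide; rewrite -gC// /hcosh -gxy subrr expr0n/= addr0.
  have -> : 2 * (g x).2 * (g x).2 = 2 * (g x).2 ^+ 2 by ring.
  rewrite -lerBlDl ler_pdivlMr ?mulr_gt0 ?exprn_gt0// /a.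
  have -> : (((g y).1 - (g x).1) / 2) ^+ 2 = ((g x).1 - (g y).1) ^+ 2 / 4 by field.
  by move: ((g x).2 ^+ 2) (((g x).1 - (g y).1) ^+ 2) (k ^+ 2) => B D K; lra.
have [a00|a00] := leP 0 a.
  apply: (@oriented_width_absurd W x y g m a (g x).2) => //.
  - by rewrite [LHS]surjective_pairing; congr pair; rewrite /m /a; field.
  - by rewrite [LHS]surjective_pairing gxy; congr pair; rewrite /m /a; field.
apply: (@oriented_width_absurd W y x g m (- a) (g x).2) => //.
- by rewrite oppr_ge0 ltW.
- by rewrite sqrrN.
- by rewrite [LHS]surjective_pairing gxy; congr pair; rewrite /m /a; field.
- by rewrite [LHS]surjective_pairing; congr pair; rewrite /m /a; field.
Qed.

End width.

(** * From distances of pairs to a strict bound on the diameter *)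

Theorem theorem5p3 (R : realType) (Omega : set (R * R)) (u : R * R -> R)
  (f : R -> R) (alpha lambda : R) (p : R * R) (Rl : R) (v : R * R -> R) :
  (* Omega: unbounded open connected domain of H^2 with C^2 boundary *)
  Omega `<=` @H2 R -> open Omega -> connected Omega ->
  (forall q, @H2 R q -> forall M : R, exists z, Omega z /\ M < hdist q z) ->
  C2_boundary Omega ->
  (* f Lipschitz on (0, +oo) with f(t) >= lambda t, lambda > 1/4 *)
  (exists L : R, forall s t, 0 < s -> 0 < t -> `|f s - f t| <= L * `|s - t|) ->
  1 / 4 < lambda -> (forall t, 0 < t -> lambda * t <= f t) ->
  (* alpha: nonzero, non-positive constant *)
  alpha <= 0 -> alpha != 0 ->
  (* the overdetermined problem *)
  C2_closure Omega u ->
  (forall z, Omega z -> hlap u z + f (u z) = 0) ->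
  (forall z, Omega z -> 0 < u z) ->
  (forall z, hbdry Omega z -> u z = 0) ->
  normal_deriv_eq Omega u alpha ->
  (* Rl = R_{lambda,2}, v the normalized positive first Dirichlet eigenfunction
     on the geodesic ball B(p, Rl) *)
  @H2 R p -> 0 < Rl -> first_dirichlet_eig (hball p Rl) = lambda ->
  C2_closure (hball p Rl) v ->
  (forall z, hball p Rl z -> hlap v z + lambda * v z = 0) ->
  (forall z, hball p Rl z -> 0 < v z) ->
  (forall z, hbdry (hball p Rl) z -> v z = 0) ->
  normal_deriv_eq (hball p Rl) v alpha ->
  (* conclusion: with h0 = v(p), every connected component of
     {x in Omega | u x > h0} has (hyperbolic) diameter < 2 Rl *)
  forall x0, Omega x0 -> v p < u x0 ->
  exists c : R, c < 2 * Rl /\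
    forall x y,
      connected_component [set z | Omega z /\ v p < u z] x0 x ->
      connected_component [set z | Omega z /\ v p < u z] x0 y ->
      hdist x y <= c.
Proof.
move=> OmH oOm _ _ bOm _ lam4 hf al0 aln0 c2u pdeu posu bdu nu p0 R0 _ c2v pdev posv bdv nv.
move=> x0 Ox0 ux0.
have a0 : alpha < 0 by rewrite lt_neqAle aln0.
have l0 : 0 <= lambda by lra.
pose k := coshr Rl; have k1 : 1 < k by exact: coshr_gt1.
move: c2v pdev posv bdv nv; rewrite (hballE p0 (ltW R0)) -/k => c2v pdev posv bdv nv.
have [C2v [cv _]] := c2v; have [C2u [cu _]] := c2u.
have ev : ball_eigen lambda p k v.
  split.
  - by rewrite -hclosure_hdisc.
  - move=> z dz; split; [exact: (C2_on_D2 (hdisc_open p0) C2v dz)|exact: pdev|exact: posv].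
  - move=> z z0 zk; apply: bdv; split => //; split.
      by apply: hdisc_closure => //; split => //; rewrite zk.
    by move=> [_]; rewrite zk ltxx.
have ov : overdetermined (hdisc p k) v alpha.
  split; [by move=> z []|by move=> y /C2v[]|exact: cv|exact: bdv|exact: nv].
have ou : overdetermined Omega u alpha.
  split; [exact: OmH|by move=> y /C2u[]|exact: cu|exact: bdu|exact: nu].
have hu z : Omega z -> [/\ D2 u z, hlap u z + lambda * u z <= 0 & 0 < u z].
  move=> Oz; split; [exact: (C2_on_D2 oOm C2u Oz)| |exact: posu].
  have := pdeu z Oz; have := hf _ (posu z Oz).
  by move: (hlap u z) (f (u z)) (lambda * u z) => a b c h1 h2; rewrite -h2 lerD2l.
pose S := [set z | Omega z /\ v p < u z]; pose W := connected_component S x0.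
have WS : W `<=` S by exact: connected_component_sub.
have cW : connected W by exact: component_connected.
have Wx0 : W x0 by apply: connected_component_refl.
have vp0 : 0 < v p by apply: posv; split => //; rewrite hcosh_refl.
have narrow x y : W x -> W y -> hcosh x y < 2 * k ^+ 2 - 1.
  move=> Wx Wy; have [Ox ux] := WS _ Wx; have [Oy uy] := WS _ Wy.
  apply: (superlevel_width l0 a0 k1 p0 oOm ou bOm hu ev ov cW WS) => //;
    by [exact: subset_closure|exact: ltW].
have x0H : H2 x0 by exact: OmH.
have kk : 1 <= 2 * k ^+ 2 - 1 by nra.
(* The bound on pairs confines [W] to one closed disc about [x0]; hence its closure is compact and
   the largest distance is attained. *)
have clB : closure W `<=` hdiscbar x0 (2 * k ^+ 2 - 1).
  move=> z clz; apply: (hdiscbar_closed x0H kk) => B /clz[w [Ww Bw]].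
  exists w; split => //; split; first by have [/OmH] := WS _ Ww.
  by apply: ltW; exact: narrow.
have cK : compact (closure W).
  exact: (subclosed_compact (@closed_closure _ W) (hdiscbar_compact x0H kk) clB).
have clH z : closure W z -> H2 z by move=> /clB[].
(* A limit point on the boundary of [Omega] would have [u = 0], while by continuity [u] is at least
   [v p > 0]. *)
have clO z : closure W z -> Omega z /\ v p <= u z.
  move=> clz; have z0 := clH _ clz.
  have zO : hclosure Omega z.
    by split => // B /clz[w [/WS[Ow _] Bw]]; exists w.
  have uz : v p <= u z.
    rewrite leNgt; apply/negP => lt.
    have h := (subspace_continuousP _ u).1 cu z zO.
    have H : \forall w \near z, hclosure Omega w -> u w < v p.
      exact: (h [set r | r < v p] (open_nbhs_nbhs (conj (@open_lt R _) lt))).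
    have [w [/WS[Ow uw] hw]] := clz _ H.
    have := hw (conj (subset_closure Ow) (OmH _ Ow)).
    by rewrite ltNge (ltW uw).
  split => //; apply: contrapT => nO.
  by have := bdu z (conj (conj zO.1 nO) z0) => e; move: uz; rewrite e leNgt vp0.
(* The extremal pair lies in the closure, where [superlevel_width] still gives a strict inequality;
   its distance is the required bound. *)
have [||q qK qmax] := @compact_EVT_max _ R (fun q : (R * R) * (R * R) => hcosh q.1 q.2)
  (closure W `*` closure W) _ (compact_setX cK cK).
- by exists (x0, x0); split; exact: subset_closure.
- apply: continuous_in_subspaceT => q; rewrite inE => -[q1 q2].
  apply: (@hcosh_continuous _ _ fst snd q).
  + exact: cvg_fst.
  + exact: cvg_snd.
  + exact: clH.
  + exact: clH.
have [q1 q2] : (closure W `*` closure W) q by rewrite inE in qK.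
have [Oq1 uq1] := clO _ q1; have [Oq2 uq2] := clO _ q2.
exists (hdist q.1 q.2); split.
  rewrite /hdist -/(hcosh q.1 q.2) acosh_lt; last by lra.
    rewrite coshr_double.
    exact: (superlevel_width l0 a0 k1 p0 oOm ou bOm hu ev ov cW WS q1 q2).
  by apply: hcosh_ge1; exact: clH.
move=> x y Wx Wy.
apply: (acosh_le (s := hcosh x y) (t := hcosh q.1 q.2)).
  by apply: hcosh_ge1; apply: clH; exact: subset_closure.
by apply: (qmax (x, y)); rewrite inE; split; exact: subset_closure.
Qed.
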